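(* Let $\lambda>-1$ and let $w_L(x)=x^{\lambda}w_0(x)$ on $[0,+\infty)$ be a Laguerre-type weight as in the context, $v_L(x):=-\ln w_L(x)$. Let $t\ge0$, $\gamma>0$, let $A,B$ be real constants, and put $$w(x)=w_L(x)|x-t|^{\gamma}\bigl(A+B\theta(x-t)\bigr),\qquad x\in[0,+\infty),$$ where $\theta(x)=1$ for $x>0$ and $\theta(x)=0$ otherwise. Let $\{P_n\}$ be the monic orthogonal polynomials associated with $w$ on $[0,+\infty)$, with $h_n$ and $\beta_n$ as in the context. Then for all $n\ge0$ $$P_n'(z)=-B_n(z)P_n(z)+\beta_nA_n(z)P_{n-1}(z),$$ $$P_{n-1}'(z)=\bigl(B_n(z)+v_L'(z)\bigr)P_{n-1}(z)-A_{n-1}(z)P_n(z),$$ where $A_{-1}(z)=B_0(z):=0$, $$A_n(z)=\frac1z\left[\frac1{h_n}\int_0^{+\infty}\frac{zv_L'(z)-xv_L'(x)}{z-x}P_n^2(x)w(x)\,dx-\frac{\gamma}{h_n}\int_0^{+\infty}\frac{P_n^2(x)}{x-t}w(x)\,dx\right]+\frac{\gamma}{h_n}\int_0^{+\infty}\frac{P_n^2(x)w(x)}{(z-x)(x-t)}\,dx$$ for $n\ge0$, and $$\begin{aligned}B_n(z)=&\frac1z\left[\frac1{h_{n-1}}\int_0^{+\infty}\frac{zv_L'(z)-xv_L'(x)}{z-x}P_n(x)P_{n-1}(x)w(x)\,dx-\frac{\gamma}{h_{n-1}}\int_0^{+\infty}\frac{P_n(x)P_{n-1}(x)}{x-t}w(x)\,dx-n\right]\\&+\frac{\gamma}{h_{n-1}}\int_0^{+\infty}\frac{P_n(x)P_{n-1}(x)}{(z-x)(x-t)}w(x)\,dx\end{aligned}$$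 for $n\ge1$. When $w_L(x)=x^{\lambda}e^{-x}$ with $\lambda>-1$, these become $$A_n(z)=\frac{1-R_n(t)}{z}+\frac{\gamma}{h_n}\int_0^{+\infty}\frac{P_n^2(x)w(x)}{(z-x)(x-t)}\,dx,$$ $$B_n(z)=-\frac{r_n(t)+n}{z}+\frac{\gamma}{h_{n-1}}\int_0^{+\infty}\frac{P_n(x)P_{n-1}(x)}{(z-x)(x-t)}w(x)\,dx,$$ where $$R_n(t):=\frac{\gamma}{h_n}\int_0^{+\infty}\frac{P_n^2(x)}{x-t}w(x)\,dx,\qquad r_n(t):=\frac{\gamma}{h_{n-1}}\int_0^{+\infty}\frac{P_n(x)P_{n-1}(x)}{x-t}w(x)\,dx.$$
   Context: Weight: $w_0$ is a positive continuously differentiable function on $(0,+\infty)$, bounded near $0$; all moments $\int_0^{\infty}x^jw_L(x)\,dx$, $j=0,1,\dots$, are finite; and $\lim_{x\to+\infty}w_L(x)\pi(x)=0$ for every polynomial $\pi$. The constants $A,B$ are such that $w\ge0$ on $[0,+\infty)$ and $w$ is positive on a set of positive measure. (The constants $A,B$ are unrelated to the functions $A_n(z),B_n(z)$.) Polynomials: $P_0:=1$, $P_{-1}:=0$, and for $j\ge1$ $P_j$ is the monic polynomial of degree $j$ such that $\int_0^{\infty}P_i(x)P_j(x)w(x)\,dx=h_j\delta_{ij}$ for $i,j\ge0$. $\beta_j=h_j/h_{j-1}$ for $j\ge1$; $\beta_0$ only occurs multiplied by $0$ and may be set to $0$. Range of $z$: the identities are understood for $z\in\mathbb C\setminus\{0\}$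 at which $v_L'(z)$ is defined and under the assumption that the integrals involved converge. For $z\in(0,+\infty)$, $v_L'(z)$ is the ordinary derivative; for $z\notin[0,+\infty)$ it denotes the value at $z$ of an analytic continuation of $v_L'$, assumed to exist. Integrals are understood as improper integrals where they are not absolutely convergent. A prime denotes differentiation. *)

(* Defs.v *)
From Stdlib Require Import Reals.
From Coquelicot Require Import Coquelicot.
Open Scope R_scope.

(** * The weight *)

(* Real powers of x >= 0.  Stdlib's [Rpower 0 a] is 1, whence the guard:
   0^a = 0, which is the right value for a > 0.  For a <= 0 the value at 0 is
   a convention; it only fixes the weight at the single point 0. *)
Definition rpow (x a : R) : R := if Rlt_dec 0 x then Rpower x a else 0.

Definition theta (x : R) : R := if Rlt_dec 0 x then 1 else 0.

Definition w_lag (lam : R) (w0 : R -> R) (x : R) : R := rpow x lam * w0 x.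

Definition w_sing (wL : R -> R) (t gamma A B x : R) : R :=
  wL x * rpow (Rabs (x - t)) gamma * (A + B * theta (x - t)).

Definition v_of (wL : R -> R) (x : R) : R := - ln (wL x).

(** * Improper integrals *)

(* [is_impint f a l]: the integral of f over (a, +oo) converges to l, where f
   may be singular at a, at +oo and at finitely many interior points.  The
   half-line is cut at finitely many points and on each piece the two endpoints
   tend to their limits independently (no principal values). *)
Inductive is_impint {V : NormedModule R_AbsRing} (f : R -> V) :
    R -> V -> Prop :=
| impint_last (a : R) (l : V) :
    is_RInt_gen f (at_right a) (Rbar_locally p_infty) l -> is_impint f a l
| impint_cut (a b : R) (l1 l2 : V) :
    a < b ->
    is_RInt_gen f (at_right a) (at_left b) l1 ->
    is_impint f b l2 ->
    is_impint f a (plus l1 l2).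

Definition ex_impint {V : NormedModule R_AbsRing} (f : R -> V) (a : R) : Prop :=
  exists l : V, is_impint f a l.

Definition impintR (f : R -> R) : R :=
  iota (T := R_CompleteNormedModule) (is_impint (V := R_NormedModule) f 0).

Definition impintC (f : R -> C) : C :=
  iota (T := C_R_CompleteNormedModule) (is_impint (V := C_R_NormedModule) f 0).

(** * Assumptions on the weight *)

Definition polyR (c : nat -> R) (d : nat) (x : R) : R :=
  sum_f_R0 (fun k => c k * x ^ k) d.

Definition polyC (c : nat -> R) (d : nat) (z : C) : C :=
  sum_n (G := C_AbelianMonoid) (fun k => (RtoC (c k) * z ^ k)%C) d.

(* w0 is only meaningful on (0, +oo). *)
Record laguerre_type (lam : R) (w0 : R -> R) : Prop := {
  lt_pos : forall x, 0 < x -> 0 < w0 x;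
  lt_derivable : forall x, 0 < x -> ex_derive w0 x;
  lt_C1 : forall x, 0 < x -> continuous (Derive w0) x;
  lt_bounded : exists d M, 0 < d /\ forall x, 0 < x < d -> Rabs (w0 x) <= M;
  lt_moments : forall j : nat,
    ex_impint (V := R_NormedModule) (fun x => x ^ j * w_lag lam w0 x) 0;
  lt_decay : forall (c : nat -> R) (d : nat),
    is_lim (fun x => w_lag lam w0 x * polyR c d x) p_infty 0
}.

(* Lebesgue-null sets *)
Definition null_set (E : R -> Prop) : Prop :=
  forall eps : posreal, exists a b : nat -> R,
    (forall k, a k <= b k) /\
    (forall x, E x -> exists k, a k < x < b k) /\
    exists s, is_series (fun k => b k - a k) s /\ s <= eps.

Definition weight_admissible (w : R -> R) : Prop :=
  (forall x, 0 <= x -> 0 <= w x) /\ ~ null_set (fun x => 0 <= x /\ 0 < w x).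

(** * Orthogonal polynomials *)

(* [P n k] is the coefficient of x^k in P_n; entries with k > n are unused. *)
Definition pR (P : nat -> nat -> R) (n : nat) : R -> R := polyR (P n) n.
Definition pC (P : nat -> nat -> R) (n : nat) : C -> C := polyC (P n) n.

Definition monic_orthogonal (w : R -> R) (P : nat -> nat -> R) (h : nat -> R)
  : Prop :=
  (forall n, P n n = 1) /\
  (forall i j, is_impint (V := R_NormedModule)
     (fun x => pR P i x * pR P j x * w x) 0
     (if Nat.eq_dec i j then h j else 0)).

(* The term of index n - 1 of the sequence f extended by f_{-1} := e. *)
Definition prev {T : Type} (e : T) (f : nat -> T) (n : nat) : T :=
  match n with O => e | S m => f m end.

Definition beta (h : nat -> R) (n : nat) : R :=
  match n with O => 0 | S m => h (S m) / h m end.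

(** * Analytic continuation of v_L' *)

Definition analytic_at (F : C -> C) (y : C) : Prop :=
  exists (a : nat -> C) (r : R), 0 < r /\
    forall u : C, Cmod (u - y)%C < r ->
      is_pseries (K := C_AbsRing) (V := C_NormedModule) a (u - y)%C (F u).

Definition connectedC (D : C -> Prop) : Prop :=
  forall U W : C -> Prop, open U -> open W ->
    (forall y, D y -> U y \/ W y) ->
    (exists y, D y /\ U y) -> (exists y, D y /\ W y) ->
    exists y, D y /\ U y /\ W y.

Definition analytic_continuation (g : R -> R) (D : C -> Prop) (F : C -> C)
  : Prop :=
  open D /\ connectedC D /\
  (forall y, D y -> analytic_at F y) /\
  (forall x : R, 0 < x -> D (RtoC x) /\ F (RtoC x) = RtoC (g x)).

(* [value_at g z gz]: the function g on (0, +oo) has the value gz at z, by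
   analytic continuation if z is not in [0, +oo).  No value exists at z = 0. *)
Definition value_at (g : R -> R) (z gz : C) : Prop :=
  (exists x : R, 0 < x /\ z = RtoC x /\ gz = RtoC (g x)) \/
  ((~ exists x : R, 0 <= x /\ z = RtoC x) /\
   exists (D : C -> Prop) (F : C -> C),
     analytic_continuation g D F /\ D z /\ gz = F z).

(** * The functions A_n and B_n *)

Section Ladder.

(* dv stands for v_L' on (0, +oo), and dvz for v_L'(z). *)
Context (gamma t : R) (dv w : R -> R) (P : nat -> nat -> R) (h : nat -> R)
        (z dvz : C).

Definition quot_integrand (i j : nat) (x : R) : C :=
  ((z * dvz - RtoC (x * dv x)) / (z - RtoC x)
     * RtoC (pR P i x * pR P j x * w x))%C.

Definition pole_integrand (i j : nat) (x : R) : R :=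
  pR P i x * pR P j x / (x - t) * w x.

Definition cauchy_integrand (i j : nat) (x : R) : C :=
  (RtoC (pR P i x * pR P j x * w x) / ((z - RtoC x) * RtoC (x - t)))%C.

Definition integrals_converge (i j : nat) : Prop :=
  ex_impint (V := C_R_NormedModule) (quot_integrand i j) 0 /\
  ex_impint (V := R_NormedModule) (pole_integrand i j) 0 /\
  ex_impint (V := C_R_NormedModule) (cauchy_integrand i j) 0.

Definition A_converges (n : nat) : Prop := integrals_converge n n.

Definition B_converges (n : nat) : Prop :=
  match n with O => True | S m => integrals_converge (S m) m end.

Definition A_fun (n : nat) : C :=
  (1 / z * (1 / RtoC (h n) * impintC (quot_integrand n n)
            - RtoC gamma / RtoC (h n) * RtoC (impintR (pole_integrand n n)))
   + RtoC gamma / RtoC (h n) * impintC (cauchy_integrand n n))%C.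

Definition B_fun (n : nat) : C :=
  match n with
  | O => 0%C
  | S m =>
    (1 / z * (1 / RtoC (h m) * impintC (quot_integrand n m)
              - RtoC gamma / RtoC (h m) * RtoC (impintR (pole_integrand n m))
              - RtoC (INR n))
     + RtoC gamma / RtoC (h m) * impintC (cauchy_integrand n m))%C
  end.

Definition R_aux (n : nat) : R :=
  gamma / h n * impintR (pole_integrand n n).

(* meaningful for n >= 1 *)
Definition r_aux (n : nat) : R :=
  gamma / h (n - 1)%nat * impintR (pole_integrand n (n - 1)).

End Ladder.

(* Main.v *)
(* With n = m + 1, the polynomial
     K(x) = (P_n(z) P_m(x) - P_m(z) P_n(x)) / (z - x)
   satisfies int p K w = h_m p(z) for every polynomial p of degree at most m, by
   orthogonality of P_m and P_n to the divided differences (p(z) - p(x)) / (z - x).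
   Let p be P_n or P_m. The function x p(x) K(x) w(x) vanishes at 0, t and +oo, so
   its derivative has integral 0. Reproduction by K and orthogonality evaluate the
   polynomial part x p' K + p (x K)' as a multiple of z p'(z) and p(z); the part
   p K x w' produces, after x / (z - x) = z / (z - x) - 1, exactly the integrals in
   A_n, A_{n-1} and B_n.
   For w_L = x^lam e^{-x} the identity theorem gives z v_L'(z) = z - lam, so the
   first integrals in A_n and B_n reduce to orthogonality relations. *)

Require Import Defs.
From Stdlib Require Import Reals Lra Lia List Classical.
From Coquelicot Require Import Coquelicot.
Open Scope R_scope.

(** * Improper integrals through primitives *)

(** The integrals may converge only conditionally, and for z on the positive half-line the Cauchy
    integrands are singular at z as well as at t. Integrals are therefore handled through continuous
    primitives with finitely many exceptional points; linearity, positivity and uniqueness become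
    statements about such primitives, and integrands may be changed at finitely many points. The
    role of K is to remove the pole: x p K w contains no 1 / (z - x), so it can be differentiated
    and integrated whether or not z lies on the half-line. The pole appears only when the vanishing
    integral is split into the given integrals, whose convergence is assumed at that point. Solving
    for p'(z) divides by h_m, and for p = P_n also by h_n. That these norms are nonzero follows from
    admissibility of w, which forces w to be positive on a whole interval, where a monic polynomial
    has nonzero values off any finite set. *)

Definition clear_of (S : list R) (u v : R) : Prop :=
  forall s, In s S -> ~ u <= s <= v.

(** Continuity is demanded at the exceptional points too: it ties the constants of neighbouring
    pieces together, so that F is determined up to a single constant. *)
Definition primitive_off (f : R -> R) (a : R) (S : list R) (F : R -> R) : Prop :=
  (forall x, a < x -> continuous F x) /\
  (forall u v, a < u -> u <= v -> clear_of S u v ->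
     is_RInt (V := R_NormedModule) f u v (F v - F u)).

(* The existence of one primitive absorbs the choice of the cutting points in
   [is_impint], which makes linearity and uniqueness immediate. *)
Definition has_impint (f : R -> R) (a l : R) : Prop :=
  exists (F : R -> R) (S : list R) (la lb : R),
    primitive_off f a S F /\
    filterlim F (at_right a) (locally la) /\
    filterlim F (Rbar_locally p_infty) (locally lb) /\
    l = lb - la.

Lemma at_right_between (a u : R) :
  a < u -> at_right a (fun x => a < x <= u).
Proof.
intros H; exists (mkposreal (u - a) ltac:(lra)); intros y Hy Hay.
apply Rabs_def2 in Hy; unfold minus, plus, opp in Hy; simpl in Hy; lra.
Qed.

Lemma at_left_between (b u : R) :
  u < b -> at_left b (fun x => u <= x < b).
Proof.
intros H; exists (mkposreal (b - u) ltac:(lra)); intros y Hy Hyb.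
apply Rabs_def2 in Hy; unfold minus, plus, opp in Hy; simpl in Hy; lra.
Qed.

(** [Fb] is the filter at the right end of a piece, [at_left b] or [Rbar_locally p_infty], and [I]
    holds for the points before that end. The Cauchy criterion turns the joint limit at both ends
    into separate limits of one primitive. *)
Lemma is_RInt_gen_primitive (f : R -> R) (a c : R) (I : R -> Prop)
    (Fb : (R -> Prop) -> Prop) (l : R) :
  ProperFilter Fb ->
  a < c -> I c -> Fb I ->
  (forall x y, I x -> y <= x -> I y) ->
  (forall x, I x -> Fb (fun y => x <= y)) ->
  (forall x, I x -> locally x I) ->
  is_RInt_gen (V := R_NormedModule) f (at_right a) Fb l ->
  exists (F : R -> R) (la lb : R),
    (forall x, a < x -> I x -> continuous F x) /\
    (forall u v, a < u -> a < v -> I u -> I v ->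
       is_RInt (V := R_NormedModule) f u v (F v - F u)) /\
    filterlim F (at_right a) (locally la) /\
    filterlim F Fb (locally lb) /\
    l = lb - la.
Proof.
intros PF Hac Ic FbI Idown Iev Iopen Hl.
(* The points u, v lie inside some [u', v'] on which the filters provide an integral; the target set
   is trivial because only existence matters. *)
assert (Hex1 : forall u v, a < u -> u <= v -> I v -> ex_RInt (V := R_NormedModule) f u v).
{ intros u v Hau Huv Iv.
  destruct (Hl (fun _ => True) (filter_true (F := locally l))) as [Q R' HQ HR HQR].
  destruct (filter_ex (F := at_right a) _ (filter_and _ _ HQ (at_right_between a u Hau)))
    as [u' [Qu' Hu']].
  destruct (filter_ex (F := Fb) _ (filter_and _ _ HR (Iev v Iv))) as [v' [Rv' Hv']].
  destruct (HQR u' v' Qu' Rv') as [y [Hy _]]; simpl in Hy.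
  apply (ex_RInt_Chasles_2 (V := R_CompleteNormedModule) f u'); [lra|].
  apply (ex_RInt_Chasles_1 (V := R_CompleteNormedModule) f u' v v'); [lra|].
  now exists y. }
assert (Hex : forall u v, a < u -> a < v -> I u -> I v -> ex_RInt (V := R_NormedModule) f u v).
{ intros u v Hu Hv Iu Iv; destruct (Rle_dec u v).
  - now apply Hex1.
  - apply ex_RInt_swap, Hex1; auto; lra. }
set (F := fun x => RInt (V := R_CompleteNormedModule) f c x).
assert (HF : forall u v, a < u -> a < v -> I u -> I v ->
   is_RInt (V := R_NormedModule) f u v (F v - F u)).
{ intros u v Hu Hv Iu Iv.
  replace (F v - F u) with (plus (opp (F u)) (F v))
    by (unfold plus, opp; simpl; ring).
  apply (is_RInt_Chasles (V := R_NormedModule)) with c.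
  - apply (is_RInt_swap (V := R_NormedModule)).
    apply (RInt_correct (V := R_CompleteNormedModule)), Hex; auto.
  - apply (RInt_correct (V := R_CompleteNormedModule)), Hex; auto. }
assert (Heps : forall eps : posreal, exists Q R' : R -> Prop,
   at_right a Q /\ Fb R' /\
   forall u v, Q u -> R' v -> Rabs (F v - F u - l) < eps).
{ intros eps.
  destruct (Hl (ball (M := R_NormedModule) l eps) (locally_ball (T := R_NormedModule) l eps)) as [Q R' HQ HR HQR].
  exists (fun x => Q x /\ a < x <= c), (fun x => R' x /\ I x /\ c <= x).
  split; [|split].
  - apply filter_and; [exact HQ | now apply at_right_between].
  - apply filter_and; [exact HR | apply filter_and; auto].
  - intros u v [Qu Hu] [Rv [Iv Hv]].
    destruct (HQR u v Qu Rv) as [y [Hy Hb]]; simpl in Hy.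
    replace (F v - F u) with y; [exact Hb|].
    assert (Iu : I u) by (apply (Idown c); [auto | lra]).
    assert (Hau : a < u) by lra. assert (Hav : a < v) by lra.
    rewrite <- (is_RInt_unique (V := R_CompleteNormedModule) f u v y Hy).
    exact (is_RInt_unique (V := R_CompleteNormedModule) f u v _ (HF u v Hau Hav Iu Iv)). }
(* Two left endpoints are compared through a common right endpoint y, with both integrals within eps
   / 2 of l. *)
assert (Hla : exists la : R, filterlim F (at_right a) (locally la)).
{ apply (filterlim_locally_cauchy (U := R_CompleteSpace) (F := at_right a)).
  intros eps.
  destruct (Heps (pos_div_2 eps)) as [Q [R' [HQ [HR HQR]]]].
  exists Q; split; [exact HQ|]; intros u v Qu Qv.
  destruct (filter_ex (F := Fb) _ HR) as [y Ry].
  pose proof (HQR u y Qu Ry) as H1; pose proof (HQR v y Qv Ry) as H2.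
  simpl in H1, H2; apply Rabs_def2 in H1; apply Rabs_def2 in H2.
  change (Rabs (F v - F u) < eps); apply Rabs_def1; lra. }
destruct Hla as [la Hla].
exists F, la, (l + la); split; [|split; [exact HF|split; [exact Hla|split; [|ring]]]].
- intros x Hx Ix.
  apply (continuous_RInt_1 (V := R_NormedModule) f c x F).
  assert (Hl' : locally x (fun y => I y /\ a < y)).
  { apply filter_and; [now apply Iopen | now apply (open_gt a)]. }
  revert Hl'; apply filter_imp; intros y [Iy Hy].
  apply (RInt_correct (V := R_CompleteNormedModule)), Hex; auto.
- apply filterlim_locally; intros eps.
  destruct (Heps (pos_div_2 eps)) as [Q [R' [HQ [HR HQR]]]].
  revert HR; apply filter_imp; intros v Rv.
  apply filterlim_locally with (eps := pos_div_2 eps) in Hla.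
  destruct (filter_ex (F := at_right a) _ (filter_and _ _ HQ Hla)) as [u [Qu Hu]].
  pose proof (HQR u v Qu Rv) as H1; change (Rabs (F u - la) < pos_div_2 eps) in Hu.
  simpl in H1, Hu; apply Rabs_def2 in H1; apply Rabs_def2 in Hu.
  change (Rabs (F v - (l + la)) < eps); apply Rabs_def1; lra.
Qed.

Lemma clear_of_cons (s : R) (S : list R) (u v : R) :
  clear_of (s :: S) u v -> ~ u <= s <= v /\ clear_of S u v.
Proof.
intros H; split; [apply H; now left | intros s' Hs'; apply H; now right].
Qed.

Lemma clear_of_app (S T : list R) (u v : R) :
  clear_of (S ++ T) u v -> clear_of S u v /\ clear_of T u v.
Proof.
intros H; split; intros s Hs; apply H, in_or_app; auto.
Qed.

Lemma continuous_at_left (F : R -> R) (x : R) :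
  continuous F x -> filterlim F (at_left x) (locally (F x)).
Proof.
intros H; eapply filterlim_filter_le_1; [|exact H]; apply filter_le_within.
Qed.

Lemma continuous_at_right (F : R -> R) (x : R) :
  continuous F x -> filterlim F (at_right x) (locally (F x)).
Proof.
intros H; eapply filterlim_filter_le_1; [|exact H]; apply filter_le_within.
Qed.

Lemma continuous_of_sides (F : R -> R) (x : R) :
  filterlim F (at_left x) (locally (F x)) ->
  filterlim F (at_right x) (locally (F x)) -> continuous F x.
Proof.
intros Hl Hr; apply filterlim_locally; intros eps.
apply filterlim_locally with (eps := eps) in Hl.
apply filterlim_locally with (eps := eps) in Hr.
unfold at_left, at_right, within in Hl, Hr.
generalize (filter_and _ _ Hl Hr); apply filter_imp; intros y [Hy1 Hy2].
destruct (Rtotal_order y x) as [H|[H|H]]; [now apply Hy1 | | now apply Hy2].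
rewrite H; apply ball_center.
Qed.

Lemma filterlim_Rplus {T : Type} (G : (T -> Prop) -> Prop) (f g : T -> R) (c d : R) :
  Filter G -> filterlim f G (locally c) -> filterlim g G (locally d) ->
  filterlim (fun x => f x + g x) G (locally (c + d)).
Proof.
intros HG Hf Hg.
apply (filterlim_comp_2 (H := locally d) _ _ Rplus Hf Hg).
apply (filterlim_plus (V := R_NormedModule)).
Qed.

Lemma filterlim_Rscal {T : Type} (G : (T -> Prop) -> Prop) (f : T -> R) (k c : R) :
  Filter G -> filterlim f G (locally c) ->
  filterlim (fun x => k * f x) G (locally (k * c)).
Proof.
intros HG Hf; apply (filterlim_comp _ _ _ f (fun y => k * y) G (locally c)); [exact Hf|].
apply (filterlim_scal_r (V := R_NormedModule) k c).
Qed.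

Lemma filterlim_Rminus_const {T : Type} (G : (T -> Prop) -> Prop) (f : T -> R) (c d : R) :
  Filter G -> filterlim f G (locally c) -> filterlim (fun x => f x - d) G (locally (c - d)).
Proof.
intros HG Hf; apply (filterlim_Rplus G f (fun _ => - d)); auto; apply filterlim_const.
Qed.

Lemma is_impint_has_impint (f : R -> R) (a l : R) :
  is_impint (V := R_NormedModule) f a l -> has_impint f a l.
Proof.
induction 1 as [a l H|a b l1 l2 Hab H1 H2 IH].
- destruct (is_RInt_gen_primitive f a (a + 1) (fun _ => True)
     (Rbar_locally p_infty) l) as [F [la [lb [Hc [HF [Ha [Hb Hl]]]]]]]; auto.
  + apply Rbar_locally_filter.
  + lra.
  + exists 0; auto.
  + intros x _; exists x; intros y; lra.
  + intros x _; apply filter_true.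
  + exists F, nil, la, lb; repeat split; auto.
    intros u v Hu Huv _; apply HF; auto; lra.
- destruct (is_RInt_gen_primitive f a ((a + b) / 2) (fun x => x < b)
     (at_left b) l1) as [F1 [la1 [lb1 [Hc1 [HF1 [Ha1 [Hb1 Hl1]]]]]]]; auto.
  + apply at_left_proper_filter.
  + lra.
  + lra.
  + generalize (at_left_between b a Hab); apply filter_imp; intros; lra.
  + intros x y; lra.
  + intros x Hx; generalize (at_left_between b x Hx); apply filter_imp; intros; lra.
  + intros x Hx; now apply (open_lt b).
  + destruct IH as [F2 [S [la2 [lb2 [[Hc2 HF2] [Ha2 [Hb2 Hl2]]]]]]].
    (* Both pieces are shifted to have limit 0 at b, so the value 0 there makes the glued primitive
       continuous; b becomes an exceptional point. *)
    set (F := fun x => match Rlt_dec x b with left _ => F1 x - lb1 | right _ =>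
      match Rlt_dec b x with left _ => F2 x - la2 | right _ => 0 end end).
    assert (FE1 : forall x, x < b -> F x = F1 x - lb1).
    { intros x Hx; unfold F; destruct (Rlt_dec x b); lra. }
    assert (FE2 : forall x, b < x -> F x = F2 x - la2).
    { intros x Hx; unfold F; destruct (Rlt_dec x b); [lra|].
      destruct (Rlt_dec b x); lra. }
    assert (FE0 : F b = 0).
    { unfold F; destruct (Rlt_dec b b); [lra|]; reflexivity. }
    exists F, (b :: S), (la1 - lb1), (lb2 - la2).
    split; [split|split; [|split]].
    * intros x Hx; destruct (Rtotal_order x b) as [H|[H|H]].
      -- apply (continuous_ext_loc _ (fun x => F1 x - lb1)).
         { generalize (open_lt b x H); apply filter_imp; intros y Hy.
           symmetry; now apply FE1. }
         apply (continuous_minus (V := R_NormedModule)); [now apply Hc1|apply continuous_const].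
      -- subst x; apply continuous_of_sides; rewrite FE0.
         ++ apply (filterlim_ext_loc (fun x => F1 x - lb1)).
            { generalize (at_left_between b a Hab); apply filter_imp; intros y Hy.
              symmetry; apply FE1; lra. }
            replace 0 with (lb1 - lb1) by ring; apply filterlim_Rminus_const; [apply at_left_proper_filter|auto].
         ++ apply (filterlim_ext_loc (fun x => F2 x - la2)).
            { generalize (at_right_between b (b + 1) ltac:(lra)); apply filter_imp; intros y Hy.
              symmetry; apply FE2; lra. }
            replace 0 with (la2 - la2) by ring; apply filterlim_Rminus_const; [apply at_right_proper_filter|auto].
      -- apply (continuous_ext_loc _ (fun x => F2 x - la2)).
         { generalize (open_gt b x H); apply filter_imp; intros y Hy.
           symmetry; now apply FE2. }
         apply (continuous_minus (V := R_NormedModule)); [now apply Hc2|apply continuous_const].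
    * intros u v Hu Huv Hcl; destruct (clear_of_cons _ _ _ _ Hcl) as [Hb Hcl'].
      destruct (Rlt_dec v b) as [Hvb|Hvb].
      -- rewrite !FE1 by lra.
         replace (F1 v - lb1 - (F1 u - lb1)) with (F1 v - F1 u) by ring.
         apply HF1; lra.
      -- rewrite !FE2 by lra.
         replace (F2 v - la2 - (F2 u - la2)) with (F2 v - F2 u) by ring.
         apply HF2; auto; lra.
    * apply (filterlim_ext_loc (fun x => F1 x - lb1)).
      { generalize (at_right_between a ((a + b) / 2) ltac:(lra)); apply filter_imp; intros y Hy.
        symmetry; apply FE1; lra. }
      apply filterlim_Rminus_const; [apply at_right_proper_filter|auto].
    * apply (filterlim_ext_loc (fun x => F2 x - la2)).
      { exists b; intros y Hy; symmetry; now apply FE2. }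
      apply filterlim_Rminus_const; [apply (Rbar_locally_filter p_infty)|auto].
    * unfold plus; simpl; lra.
Qed.

Lemma has_impint_plus (f g : R -> R) (a l m : R) :
  has_impint f a l -> has_impint g a m -> has_impint (fun x => f x + g x) a (l + m).
Proof.
intros [F [S [la [lb [[Fc FI] [Fa [Fb El]]]]]]] [G [T [ma [mb [[Gc GI] [Ga [Gb Em]]]]]]].
exists (fun x => F x + G x), (S ++ T), (la + ma), (lb + mb).
split; [split|split; [|split]].
- intros x Hx; apply (continuous_plus (V := R_NormedModule)); auto.
- intros u v Hu Huv H; apply clear_of_app in H; destruct H as [H1 H2].
  replace (F v + G v - (F u + G u)) with (plus (F v - F u) (G v - G u))
    by (unfold plus; simpl; ring).
  apply (is_RInt_plus (V := R_NormedModule)); auto.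
- apply filterlim_Rplus; auto; apply at_right_proper_filter.
- apply filterlim_Rplus; auto; apply (Rbar_locally_filter p_infty).
- lra.
Qed.

Lemma has_impint_scal (f : R -> R) (a k l : R) :
  has_impint f a l -> has_impint (fun x => k * f x) a (k * l).
Proof.
intros [F [S [la [lb [[Fc FI] [Fa [Fb El]]]]]]].
exists (fun x => k * F x), S, (k * la), (k * lb).
split; [split|split; [|split]].
- intros x Hx; apply (continuous_scal_r (V := R_NormedModule)); auto.
- intros u v Hu Huv H.
  replace (k * F v - k * F u) with (scal k (F v - F u))
    by (unfold scal; simpl; unfold mult; simpl; ring).
  apply (is_RInt_scal (V := R_NormedModule)); auto.
- apply filterlim_Rscal; auto; apply at_right_proper_filter.
- apply filterlim_Rscal; auto; apply (Rbar_locally_filter p_infty).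
- rewrite El; ring.
Qed.

(** The points of disagreement join the exceptional set of the primitive. This is what later permits
    pointwise identities that divide by x - t and z - x. *)
Lemma has_impint_ext (S : list R) (f g : R -> R) (a l : R) :
  (forall x, a < x -> ~ In x S -> f x = g x) ->
  has_impint f a l -> has_impint g a l.
Proof.
intros H [F [T [la [lb [[Fc FI] HF]]]]].
exists F, (S ++ T), la, lb; split; [|exact HF].
split; [exact Fc|]; intros u v Hu Huv Hcl.
apply clear_of_app in Hcl; destruct Hcl as [H1 H2].
apply (is_RInt_ext (V := R_NormedModule) f); auto.
rewrite Rmin_left, Rmax_right by lra; intros x Hx.
apply H; [lra|]; intros Hin; apply (H1 x Hin); lra.
Qed.

Lemma has_impint_zero (a : R) : has_impint (fun _ => 0) a 0.
Proof.
exists (fun _ => 0), nil, 0, 0; split; [split|split; [|split]].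
- intros x _; apply continuous_const.
- intros u v _ _ _; replace (0 - 0) with (scal (V := R_NormedModule) (v - u) 0)
    by (unfold scal; simpl; unfold mult; simpl; ring).
  apply (is_RInt_const (V := R_NormedModule)).
- apply filterlim_const.
- apply filterlim_const.
- ring.
Qed.

(** * Monotone primitives: positivity and uniqueness of the integral *)

Lemma limit_le (G : (R -> Prop) -> Prop) (f : R -> R) (l y : R) :
  ProperFilter G -> filterlim f G (locally l) -> G (fun x => f x <= y) -> l <= y.
Proof.
intros PG Hf HG; apply (filterlim_le (F := G) f (fun _ => y) l y); auto.
apply filterlim_const.
Qed.

Lemma limit_ge (G : (R -> Prop) -> Prop) (f : R -> R) (l y : R) :
  ProperFilter G -> filterlim f G (locally l) -> G (fun x => y <= f x) -> y <= l.
Proof.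
intros PG Hf HG; apply (filterlim_le (F := G) (fun _ => y) f y l); auto.
apply filterlim_const.
Qed.

(** An exceptional point s in [u, v] is crossed by one-sided limits: continuity gives F u <= F s
    from the left and F s <= F v from the right. *)
Lemma nondecreasing_off_finite (F : R -> R) (a : R) (S : list R) :
  (forall x, a < x -> continuous F x) ->
  (forall u v, a < u -> u <= v -> clear_of S u v -> F u <= F v) ->
  forall u v, a < u -> u <= v -> F u <= F v.
Proof.
intros Fc; induction S as [|s S IH]; intros H u v Hu Huv.
- apply H; auto; intros s [].
(* The induction hypothesis leaves intervals clear of the remaining points, so s is the only
   possible obstruction in [u, v]. *)
- revert u v Hu Huv; cut (forall u v, a < u -> u <= v -> clear_of S u v -> F u <= F v);
    [exact IH|].
  intros u v Hu Huv Hcl.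
  assert (Hsub : forall u' v', u <= u' -> v' <= v -> u' <= v' -> ~ u' <= s <= v' -> F u' <= F v').
  { intros u' v' H1 H2 H3 H4; apply H; [lra|lra|]; intros s' [Es|Hs'].
    - now subst s'.
    - intros Hb; apply (Hcl s' Hs'); lra. }
  assert (H1 : u <= s <= v -> F u <= F s).
  { intros Hs; destruct (Req_dec u s) as [->|Hne]; [lra|].
    apply (limit_ge (at_left s) F (F s) (F u)).
    - apply at_left_proper_filter.
    - apply continuous_at_left, Fc; lra.
    - generalize (at_left_between s u ltac:(lra)); apply filter_imp; intros x Hx.
      apply Hsub; lra. }
  assert (H2 : u <= s <= v -> F s <= F v).
  { intros Hs; destruct (Req_dec s v) as [->|Hne]; [lra|].
    apply (limit_le (at_right s) F (F s) (F v)).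
    - apply at_right_proper_filter.
    - apply continuous_at_right, Fc; lra.
    - generalize (at_right_between s v ltac:(lra)); apply filter_imp; intros x Hx.
      apply Hsub; lra. }
  destruct (Rle_dec u s), (Rle_dec s v); try (apply Hsub; lra).
  apply Rle_trans with (F s); auto.
Qed.

Lemma primitive_off_nondecreasing (f F : R -> R) (a : R) (S : list R) :
  (forall x, a < x -> 0 <= f x) -> primitive_off f a S F ->
  forall u v, a < u -> u <= v -> F u <= F v.
Proof.
intros Hf [Fc FI].
apply (nondecreasing_off_finite F a S Fc); intros u v Hu Huv Hcl.
cut (0 <= F v - F u); [lra|].
apply (is_RInt_ge_0 f u v); auto; intros x Hx; apply Hf; lra.
Qed.

Lemma has_impint_nonneg (f : R -> R) (a l : R) :
  (forall x, a < x -> 0 <= f x) -> has_impint f a l -> 0 <= l.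
Proof.
intros Hf [F [S [la [lb [HF [Fa [Fb ->]]]]]]].
assert (Hm := primitive_off_nondecreasing f F a S Hf HF).
assert (H1 : la <= F (a + 1)).
{ apply (limit_le (at_right a) F); auto; [apply at_right_proper_filter|].
  generalize (at_right_between a (a + 1) ltac:(lra)); apply filter_imp; intros x Hx.
  apply Hm; lra. }
assert (H2 : F (a + 1) <= lb).
{ apply (limit_ge (Rbar_locally p_infty) F); auto; [apply Rbar_locally_filter|].
  exists (a + 1); intros x Hx; apply Hm; lra. }
lra.
Qed.

(** For two values l and m, the function f - f = 0 has integral m - l, which is nonnegative; the
    roles of l and m can be exchanged. *)
Lemma has_impint_unique (f : R -> R) (a l m : R) :
  has_impint f a l -> has_impint f a m -> l = m.
Proof.
intros Hl Hm.
assert (key : forall l m, has_impint f a l -> has_impint f a m -> l <= m).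
{ intros l' m' Hl' Hm'; cut (0 <= m' + -1 * l'); [lra|].
  apply (has_impint_nonneg (fun x => f x + -1 * f x) a).
  - intros x _; lra.
  - apply has_impint_plus; [exact Hm'|now apply has_impint_scal]. }
apply Rle_antisym; auto.
Qed.

(** A nondecreasing primitive with equal limits at both ends is constant, and its derivative at a
    point of continuity off S is f. This serves to show h_n <> 0. *)
Lemma has_impint_zero_nonneg (f : R -> R) (a : R) :
  (forall x, a < x -> 0 <= f x) -> has_impint f a 0 ->
  exists S, forall x, a < x -> ~ In x S -> continuous f x -> f x = 0.
Proof.
intros Hf [F [S [la [lb [HF [Fa [Fb Hl]]]]]]].
assert (Hm := primitive_off_nondecreasing f F a S Hf HF).
destruct HF as [Fc FI].
assert (HFa : forall x, a < x -> F x = la).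
{ intros x Hx; apply Rle_antisym.
  - replace la with lb by lra.
    apply (limit_ge (Rbar_locally p_infty) F); auto; [apply Rbar_locally_filter|].
    exists x; intros y Hy; apply Hm; lra.
  - apply (limit_le (at_right a) F); auto; [apply at_right_proper_filter|].
    generalize (at_right_between a x Hx); apply filter_imp; intros y Hy.
    apply Hm; lra. }
exists S; intros x Hx Hin Hc.
(* Differentiating the integral at x requires a neighbourhood of x on which F is a primitive, hence
   one without exceptional points. *)
assert (Hgap : exists d, 0 < d /\ a < x - d /\ clear_of S (x - d) (x + d)).
{ clear -Hx Hin; induction S as [|s S IH].
  - exists ((x - a) / 2); repeat split; try lra; intros s [].
  - destruct IH as [d [Hd [Had Hcl]]]; [intros H; apply Hin; now right|].
    assert (Hs : s <> x) by (intros H; apply Hin; now left).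
    exists (Rmin d (Rabs (s - x) / 2)).
    assert (Hp : 0 < Rabs (s - x)) by (apply Rabs_pos_lt; lra).
    pose proof (Rmin_l d (Rabs (s - x) / 2)); pose proof (Rmin_r d (Rabs (s - x) / 2)).
    assert (0 < Rmin d (Rabs (s - x) / 2)) by (apply Rmin_glb_lt; lra).
    repeat split; try lra; intros s' [Es|Hs'] Hb.
    + subst s'. cut (Rabs (s - x) <= Rmin d (Rabs (s - x) / 2)); [lra|].
      apply Rabs_le; lra.
    + apply (Hcl s' Hs'); lra. }
destruct Hgap as [d [Hd [Had Hcl]]].
assert (HD : is_derive (fun y => F y - F (x - d)) x (f x)).
{ apply (is_derive_RInt (V := R_NormedModule) f _ (x - d)); [|exact Hc].
  exists (mkposreal d Hd); intros y Hy.
  apply Rabs_def2 in Hy; unfold minus, plus, opp in Hy; simpl in Hy.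
  apply FI; try lra; intros s Hs Hb; apply (Hcl s Hs); lra. }
assert (HD0 : is_derive (fun y => F y - F (x - d)) x 0).
{ apply (is_derive_ext_loc (fun _ => 0)).
  - generalize (open_gt a x Hx); apply filter_imp; intros y Hy.
    rewrite !HFa; try lra; lra.
  - apply (is_derive_const (V := R_NormedModule)). }
apply is_derive_unique in HD; apply is_derive_unique in HD0; congruence.
Qed.

(** * Complex-valued integrals by components, and the values selected by [iota] *)

Definition has_impintC (f : R -> C) (l : C) : Prop :=
  has_impint (fun x => Re (f x)) 0 (Re l) /\ has_impint (fun x => Im (f x)) 0 (Im l).

Lemma is_RInt_gen_Re (f : R -> C) (Fa Fb : (R -> Prop) -> Prop) (l : C) :
  is_RInt_gen (V := C_R_NormedModule) f Fa Fb l ->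
  is_RInt_gen (V := R_NormedModule) (fun x => Re (f x)) Fa Fb (Re l).
Proof.
intros H Q [eps HQ].
destruct (H (fun y => Q (Re y))) as [U V HU HV HUV].
{ exists eps; intros y [Hy _]; apply HQ, Hy. }
exists U V; auto; intros x y Ux Vy.
destruct (HUV x y Ux Vy) as [c [Hc Qc]]; exists (Re c); split; [|exact Qc].
exact (is_RInt_fct_extend_fst (U := R_NormedModule) (V := R_NormedModule) f _ _ c Hc).
Qed.

Lemma is_RInt_gen_Im (f : R -> C) (Fa Fb : (R -> Prop) -> Prop) (l : C) :
  is_RInt_gen (V := C_R_NormedModule) f Fa Fb l ->
  is_RInt_gen (V := R_NormedModule) (fun x => Im (f x)) Fa Fb (Im l).
Proof.
intros H Q [eps HQ].
destruct (H (fun y => Q (Im y))) as [U V HU HV HUV].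
{ exists eps; intros y [_ Hy]; apply HQ, Hy. }
exists U V; auto; intros x y Ux Vy.
destruct (HUV x y Ux Vy) as [c [Hc Qc]]; exists (Im c); split; [|exact Qc].
exact (is_RInt_fct_extend_snd (U := R_NormedModule) (V := R_NormedModule) f _ _ c Hc).
Qed.

Lemma is_impint_Re (f : R -> C) (a : R) (l : C) :
  is_impint (V := C_R_NormedModule) f a l ->
  is_impint (V := R_NormedModule) (fun x => Re (f x)) a (Re l).
Proof.
induction 1 as [a l H|a b l1 l2 Hab H1 H2 IH].
- now apply impint_last, is_RInt_gen_Re.
- apply (impint_cut (V := R_NormedModule) _ a b (Re l1) (Re l2)); auto.
  now apply is_RInt_gen_Re.
Qed.

Lemma is_impint_Im (f : R -> C) (a : R) (l : C) :
  is_impint (V := C_R_NormedModule) f a l ->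
  is_impint (V := R_NormedModule) (fun x => Im (f x)) a (Im l).
Proof.
induction 1 as [a l H|a b l1 l2 Hab H1 H2 IH].
- now apply impint_last, is_RInt_gen_Im.
- apply (impint_cut (V := R_NormedModule) _ a b (Im l1) (Im l2)); auto.
  now apply is_RInt_gen_Im.
Qed.

Lemma is_impint_has_impintC (f : R -> C) (l : C) :
  is_impint (V := C_R_NormedModule) f 0 l -> has_impintC f l.
Proof.
intros H; split; apply is_impint_has_impint; [now apply is_impint_Re|now apply is_impint_Im].
Qed.

Lemma has_impintC_unique (f : R -> C) (l m : C) :
  has_impintC f l -> has_impintC f m -> l = m.
Proof.
intros [H1 H2] [H3 H4]; rewrite (surjective_pairing l), (surjective_pairing m); f_equal.
- exact (has_impint_unique _ _ _ _ H1 H3).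
- exact (has_impint_unique _ _ _ _ H2 H4).
Qed.

Lemma has_impintC_plus (f g : R -> C) (l m : C) :
  has_impintC f l -> has_impintC g m -> has_impintC (fun x => (f x + g x)%C) (l + m)%C.
Proof.
intros [H1 H2] [H3 H4]; split.
- exact (has_impint_plus _ _ _ _ _ H1 H3).
- exact (has_impint_plus _ _ _ _ _ H2 H4).
Qed.

Lemma has_impintC_ext (S : list R) (f g : R -> C) (l : C) :
  (forall x, 0 < x -> ~ In x S -> f x = g x) -> has_impintC f l -> has_impintC g l.
Proof.
intros H [H1 H2]; split.
- revert H1; apply (has_impint_ext S); intros x Hx Hin; now rewrite (H x Hx Hin).
- revert H2; apply (has_impint_ext S); intros x Hx Hin; now rewrite (H x Hx Hin).
Qed.

Lemma has_impintC_scal (f : R -> C) (k l : C) :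
  has_impintC f l -> has_impintC (fun x => (k * f x)%C) (k * l)%C.
Proof.
intros [H1 H2]; split.
- replace (Re (k * l)) with (Re k * Re l + - Im k * Im l) by (simpl; unfold Re, Im; ring).
  apply (has_impint_ext nil) with (f := fun x => Re k * Re (f x) + - Im k * Im (f x)).
  + intros x _ _; simpl; unfold Re, Im; ring.
  + apply has_impint_plus; now apply has_impint_scal.
- replace (Im (k * l)) with (Re k * Im l + Im k * Re l) by (simpl; unfold Re, Im; ring).
  apply (has_impint_ext nil) with (f := fun x => Re k * Im (f x) + Im k * Re (f x)).
  + intros x _ _; simpl; unfold Re, Im; ring.
  + apply has_impint_plus; now apply has_impint_scal.
Qed.

Lemma has_impintC_RtoC (f : R -> R) (l : R) :
  has_impint f 0 l -> has_impintC (fun x => RtoC (f x)) (RtoC l).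
Proof.
intros H; split; [exact H|apply has_impint_zero].
Qed.

(** [iota] yields the integral once its value is unique, and uniqueness for [is_impint] is inherited
    from [has_impint]. *)
Lemma impintR_correct (f : R -> R) :
  ex_impint (V := R_NormedModule) f 0 -> has_impint f 0 (impintR f).
Proof.
intros [l Hl]; apply is_impint_has_impint.
apply (iota_correct (V := R_CompleteNormedModule) (is_impint (V := R_NormedModule) f 0)).
exists l; split; [exact Hl|]; intros m Hm.
now apply (has_impint_unique f 0); apply is_impint_has_impint.
Qed.

Lemma impintC_correct (f : R -> C) :
  ex_impint (V := C_R_NormedModule) f 0 -> has_impintC f (impintC f).
Proof.
intros [l Hl]; apply is_impint_has_impintC.
apply (iota_correct (V := C_R_CompleteNormedModule) (is_impint (V := C_R_NormedModule) f 0)).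
exists l; split; [exact Hl|]; intros m Hm.
now apply (has_impintC_unique f); apply is_impint_has_impintC.
Qed.

(** * Complex polynomials *)

(* [cpoly d a f df]: f is a complex polynomial of degree at most d in which
   z^d has coefficient a, and df is its derivative (Horner form). *)
Fixpoint cpoly (d : nat) (a : C) (f df : C -> C) : Prop :=
  match d with
  | O => forall x, f x = a /\ df x = 0%C
  | S e => exists (c : C) (g dg : C -> C), cpoly e a g dg /\
      forall x, f x = (c + x * g x)%C /\ df x = (g x + x * dg x)%C
  end.

Lemma cpoly_ext (d : nat) (a : C) (f df g dg : C -> C) :
  (forall x, f x = g x) -> (forall x, df x = dg x) ->
  cpoly d a f df -> cpoly d a g dg.
Proof.
intros H1 H2; destruct d; simpl.
- intros H x; rewrite <- H1, <- H2; auto.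
- intros [c [k [dk [Hk H]]]]; exists c, k, dk; split; [exact Hk|].
  intros x; rewrite <- H1, <- H2; auto.
Qed.

Lemma cpoly_const (a : C) : cpoly 0 a (fun _ => a) (fun _ => 0%C).
Proof. now simpl. Qed.

Lemma cpoly_plus (d : nat) (a b : C) (f df g dg : C -> C) :
  cpoly d a f df -> cpoly d b g dg ->
  cpoly d (a + b)%C (fun x => (f x + g x)%C) (fun x => (df x + dg x)%C).
Proof.
revert f df g dg; induction d as [|d IH]; simpl; intros f df g dg.
- intros Hf Hg x; destruct (Hf x) as [-> ->]; destruct (Hg x) as [-> ->]; split; ring.
- intros [c [f1 [df1 [Hf1 Hf]]]] [c' [g1 [dg1 [Hg1 Hg]]]].
  exists (c + c')%C, (fun x => (f1 x + g1 x)%C), (fun x => (df1 x + dg1 x)%C).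
  split; [now apply IH|]; intros x.
  destruct (Hf x) as [-> ->]; destruct (Hg x) as [-> ->]; split; ring.
Qed.

Lemma cpoly_scal (d : nat) (a k : C) (f df : C -> C) :
  cpoly d a f df -> cpoly d (k * a)%C (fun x => (k * f x)%C) (fun x => (k * df x)%C).
Proof.
revert f df; induction d as [|d IH]; simpl; intros f df.
- intros Hf x; destruct (Hf x) as [-> ->]; split; ring.
- intros [c [f1 [df1 [Hf1 Hf]]]].
  exists (k * c)%C, (fun x => (k * f1 x)%C), (fun x => (k * df1 x)%C).
  split; [now apply IH|]; intros x; destruct (Hf x) as [-> ->]; split; ring.
Qed.

Lemma cpoly_lift (d : nat) (a : C) (f df : C -> C) :
  cpoly d a f df -> cpoly (S d) 0%C f df.
Proof.
revert f df; induction d as [|d IH]; intros f df.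
- intros H; exists a, (fun _ => 0%C), (fun _ => 0%C); split; [apply cpoly_const|].
  intros x; destruct (H x) as [-> ->]; split; ring.
- intros [c [g [dg [Hg H]]]]; exists c, g, dg; split; [now apply IH|exact H].
Qed.

Lemma cpoly_drop (d : nat) (f df : C -> C) :
  cpoly (S d) 0%C f df -> exists a, cpoly d a f df.
Proof.
revert f df; induction d as [|d IH]; intros f df [c [g [dg [Hg H]]]].
- exists c; intros x; destruct (H x) as [-> ->]; destruct (Hg x) as [-> ->]; split; ring.
- destruct (IH g dg Hg) as [a Ha]; exists a, c, g, dg; now split.
Qed.

Lemma cpoly_mulX (d : nat) (a : C) (f df : C -> C) :
  cpoly d a f df -> cpoly (S d) a (fun x => (x * f x)%C) (fun x => (f x + x * df x)%C).
Proof.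
intros H; exists 0%C, f, df; split; [exact H|]; intros x; split; ring.
Qed.

Lemma cpoly_deriv (d : nat) (a : C) (f df : C -> C) :
  cpoly (S d) a f df -> exists ddf, cpoly d (RtoC (INR (S d)) * a)%C df ddf.
Proof.
revert f df; induction d as [|d IH]; intros f df [c [g [dg [Hg H]]]].
- exists (fun _ => 0%C); intros x; destruct (H x) as [_ ->]; destruct (Hg x) as [-> ->].
  simpl; split; ring.
- destruct (IH g dg Hg) as [ddg Hd].
  exists (fun x => (dg x + (dg x + x * ddg x))%C).
  apply (cpoly_ext _ _ (fun x => (g x + x * dg x)%C) (fun x => (dg x + (dg x + x * ddg x))%C)).
  + intros x; now destruct (H x) as [_ ->].
  + auto.
  + replace (RtoC (INR (S (S d))) * a)%C with (a + RtoC (INR (S d)) * a)%C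
      by (rewrite (S_INR (S d)), RtoC_plus; ring).
    apply cpoly_plus; [exact Hg|now apply cpoly_mulX].
Qed.

(** The factor x in x p K w makes derivatives appear as x d/dx, which preserves the degree bound;
    orthogonality then reads off the top coefficient. *)
Lemma cpoly_euler (d : nat) (a : C) (f df : C -> C) :
  cpoly d a f df ->
  exists ddf, cpoly d (RtoC (INR d) * a)%C (fun x => (x * df x)%C) ddf.
Proof.
destruct d as [|d]; intros H.
- exists (fun _ => 0%C); intros x; destruct (H x) as [_ ->]; simpl; split; ring.
- destruct (cpoly_deriv d a f df H) as [ddf Hd]; eexists; apply cpoly_mulX, Hd.
Qed.

(** For f = c + x g one has f(z) - f(x) = z (g(z) - g(x)) + (z - x) g(x), so the divided difference
    of f is z times that of g, plus g. *)
Lemma cpoly_divided_difference (d : nat) (a z : C) (f df : C -> C) :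
  cpoly (S d) a f df ->
  exists D dD, cpoly d a D dD /\ forall x, (D x * (z - x) = f z - f x)%C.
Proof.
revert f df; induction d as [|d IH]; intros f df [c [g [dg [Hg H]]]].
- exists g, dg; split; [exact Hg|]; intros x.
  destruct (H z) as [-> _]; destruct (H x) as [-> _]; destruct (Hg z) as [-> _];
    destruct (Hg x) as [-> _]; ring.
- destruct (IH g dg Hg) as [D [dD [HD E]]].
  exists (fun x => (z * D x + g x)%C), (fun x => (z * dD x + dg x)%C); split.
  + replace a with (z * 0 + a)%C by ring; apply cpoly_plus; [|exact Hg].
    now apply cpoly_scal, (cpoly_lift d a).
  + intros x; destruct (H z) as [-> _]; destruct (H x) as [-> _].
    replace ((z * D x + g x) * (z - x))%C with (z * (D x * (z - x)) + g x * (z - x))%C by ring.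
    rewrite E; ring.
Qed.

(** The bound d with top coefficient 0 replaces degree d - 1 and so covers d = 0 as well; in this
    form the moment of D against P_d is 0. *)
Lemma cpoly_divided_difference0 (d : nat) (a z : C) (f df : C -> C) :
  cpoly d a f df ->
  exists D dD, cpoly d 0%C D dD /\ forall x, (D x * (z - x) = f z - f x)%C.
Proof.
destruct d as [|d]; intros H.
- exists (fun _ => 0%C), (fun _ => 0%C); split; [apply cpoly_const|]; intros x.
  destruct (H x) as [-> _]; destruct (H z) as [-> _]; ring.
- destruct (cpoly_divided_difference d a z f df H) as [D [dD [HD E]]].
  exists D, dD; split; [now apply (cpoly_lift d a)|exact E].
Qed.

(** The product rule is stated for the normed module that [C_AbsRing] forms over itself; the two
    structures on C give the same derivative. *)
Lemma is_derive_C_NormedModule (f : C -> C) (z l : C) :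
  is_derive (K := C_AbsRing) (V := AbsRing_NormedModule C_AbsRing) f z l ->
  is_derive (K := C_AbsRing) (V := C_NormedModule) f z l.
Proof.
intros [[H1 H2 H3] H]; split; [|exact H].
split; [exact H1|exact H2|exact H3].
Qed.

Lemma is_derive_C_AbsRing (f : C -> C) (z l : C) :
  is_derive (K := C_AbsRing) (V := C_NormedModule) f z l ->
  is_derive (K := C_AbsRing) (V := AbsRing_NormedModule C_AbsRing) f z l.
Proof.
intros [[H1 H2 H3] H]; split; [|exact H].
split; [exact H1|exact H2|exact H3].
Qed.

Lemma cpoly_is_derive (d : nat) (a z : C) (f df : C -> C) :
  cpoly d a f df -> is_derive (K := C_AbsRing) (V := C_NormedModule) f z (df z).
Proof.
revert f df; induction d as [|d IH]; intros f df.
- intros H; apply (is_derive_ext (K := C_AbsRing) (V := C_NormedModule) (fun _ => a)).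
  + intros x; now destruct (H x) as [-> _].
  + destruct (H z) as [_ ->].
    apply (is_derive_const (K := C_AbsRing) (V := C_NormedModule)).
- intros [c [g [dg [Hg H]]]].
  apply (is_derive_ext (K := C_AbsRing) (V := C_NormedModule) (fun x => (c + x * g x)%C)).
  + intros x; now destruct (H x) as [-> _].
  + replace (df z) with (plus (zero : C_NormedModule) (plus (mult (one : C_AbsRing) (g z)) (mult (z : C_AbsRing) (dg z)))).
    2:{ destruct (H z) as [_ ->]; unfold plus, zero, mult, one; simpl; ring. }
    apply (is_derive_plus (K := C_AbsRing) (V := C_NormedModule) (fun _ => c) (fun x => (x * g x)%C)).
    * apply (is_derive_const (K := C_AbsRing) (V := C_NormedModule)).
    * apply is_derive_C_NormedModule.
      refine (is_derive_mult (K := C_AbsRing) (fun x => x) g z one (dg z) _ _ _).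
      -- apply (is_derive_id (K := C_AbsRing)).
      -- now apply is_derive_C_AbsRing, IH.
      -- intros; apply Cmult_comm.
Qed.

Lemma polyC_Horner (c : nat -> R) (d : nat) (z : C) :
  polyC c (S d) z = (RtoC (c O) + z * polyC (fun k => c (S k)) d z)%C.
Proof.
induction d as [|d IH]; unfold polyC in *.
- rewrite sum_Sn, !sum_O; unfold plus; simpl; ring.
- rewrite sum_Sn, IH, (sum_Sn _ d); unfold plus; simpl; ring.
Qed.

Lemma polyC_cpoly (c : nat -> R) (d : nat) :
  exists df, cpoly d (RtoC (c d)) (polyC c d) df.
Proof.
revert c; induction d as [|d IH]; intros c.
- exists (fun _ => 0%C); intros x; unfold polyC; rewrite sum_O; simpl; split; ring.
- destruct (IH (fun k => c (S k))) as [dg Hg].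
  exists (fun x => (polyC (fun k => c (S k)) d x + x * dg x)%C), (RtoC (c O)).
  exists (polyC (fun k => c (S k)) d), dg; split; [exact Hg|].
  intros x; split; [apply polyC_Horner|reflexivity].
Qed.

Lemma polyC_RtoC (c : nat -> R) (d : nat) (x : R) :
  polyC c d (RtoC x) = RtoC (polyR c d x).
Proof.
unfold polyC, polyR; induction d as [|d IH].
- rewrite sum_O; simpl; now rewrite RtoC_mult.
- rewrite sum_Sn, IH; rewrite <- RtoC_pow, <- RtoC_mult; unfold plus; simpl; now rewrite RtoC_plus.
Qed.

Lemma point_avoiding (S : list R) (u v : R) :
  u < v -> exists x, u < x < v /\ ~ In x S.
Proof.
(* A whole subinterval free of S survives the induction: each new point costs one half of it. *)
cut (forall u v, u < v -> exists u' v', u <= u' /\ u' < v' /\ v' <= v /\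
   forall x, u' < x < v' -> ~ In x S).
{ intros H Huv; destruct (H u v Huv) as [u' [v' [H1 [H2 [H3 H4]]]]].
  exists ((u' + v') / 2); split; [lra|apply H4; lra]. }
clear u v; induction S as [|s S IH]; intros u v Huv.
- exists u, v; repeat split; try lra; intros x _ [].
- destruct (IH u v Huv) as [u' [v' [H1 [H2 [H3 H4]]]]].
  destruct (Rle_dec s ((u' + v') / 2)).
  + exists ((u' + v') / 2), v'; repeat split; try lra.
    intros x Hx [Es|Hin]; [lra|]; apply (H4 x); auto; lra.
  + exists u', ((u' + v') / 2); repeat split; try lra.
    intros x Hx [Es|Hin]; [lra|]; apply (H4 x); auto; lra.
Qed.

(** At a zero x0 the divided difference lowers the degree, keeps the top coefficient a, and still
    vanishes on the interval off S and x0. *)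
Lemma cpoly_zero_on_interval (d : nat) (a : C) (f df : C -> C) (S : list R) (u v : R) :
  cpoly d a f df -> u < v ->
  (forall x, u < x < v -> ~ In x S -> f (RtoC x) = 0%C) -> a = 0%C.
Proof.
revert f df S; induction d as [|d IH]; intros f df S Hf Huv H;
  destruct (point_avoiding S u v Huv) as [x0 [Hx0 Hin0]].
- now rewrite <- (H x0 Hx0 Hin0); destruct (Hf (RtoC x0)) as [-> _].
- destruct (cpoly_divided_difference d a (RtoC x0) f df Hf) as [D [dD [HD E]]].
  apply (IH D dD (x0 :: S) HD Huv); intros x Hx Hin.
  assert (Hne : (RtoC x0 - RtoC x)%C <> 0%C).
  { intros H0; apply Hin; left; apply RtoC_inj.
    replace (RtoC x0) with ((RtoC x0 - RtoC x) + RtoC x)%C by ring; rewrite H0; ring. }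
  specialize (E (RtoC x)).
  rewrite (H x0 Hx0 Hin0), (H x Hx) in E by (intros H'; apply Hin; now right).
  replace (D (RtoC x)) with (D (RtoC x) * (RtoC x0 - RtoC x) / (RtoC x0 - RtoC x))%C
    by now field.
  rewrite E; unfold Cdiv; ring.
Qed.

(** * Integration by parts against the weight *)

(** What integration by parts asks of the cofactor of x w: a continuous derivative, and polynomial
    growth to be beaten by the decay of w_L. The instances are real and imaginary parts of
    polynomials. *)
Definition tame (q dq : R -> R) : Prop :=
  (forall x, is_derive (K := R_AbsRing) (V := R_NormedModule) q x (dq x)) /\
  (forall x, continuous dq x) /\
  exists (M : R) (N : nat), 0 <= M /\ forall x, 1 <= x -> Rabs (q x) <= M * x ^ N.

Lemma tame_continuous (q dq : R -> R) (x : R) : tame q dq -> continuous q x.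
Proof.
intros [H _]; apply (ex_derive_continuous (V := R_NormedModule)); eexists; apply H.
Qed.

Lemma tame_const (a : R) : tame (fun _ => a) (fun _ => 0).
Proof.
split; [|split].
- intros x; apply (is_derive_const (V := R_NormedModule)).
- intros x; apply continuous_const.
- exists (Rabs a), O; split; [apply Rabs_pos|]; intros x _; simpl; lra.
Qed.

Lemma tame_id : tame (fun x => x) (fun _ => 1).
Proof.
split; [|split].
- intros x; apply (is_derive_id (K := R_AbsRing)).
- intros x; apply continuous_const.
- exists 1, 1%nat; split; [lra|]; intros x Hx; rewrite Rabs_pos_eq; simpl; lra.
Qed.

Lemma tame_plus (q dq r dr : R -> R) :
  tame q dq -> tame r dr -> tame (fun x => q x + r x) (fun x => dq x + dr x).
Proof.
intros [Hq [Cq [M [N [HM Bq]]]]] [Hr [Cr [M' [N' [HM' Br]]]]]; split; [|split].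
- intros x; apply (is_derive_plus (V := R_NormedModule)); auto.
- intros x; apply (continuous_plus (V := R_NormedModule)); auto.
- exists (M + M'), (N + N')%nat; split; [lra|]; intros x Hx.
  apply Rle_trans with (1 := Rabs_triang _ _).
  assert (H1 : x ^ N <= x ^ (N + N')) by (apply Rle_pow; [lra|lia]).
  assert (H2 : x ^ N' <= x ^ (N + N')) by (apply Rle_pow; [lra|lia]).
  specialize (Bq x Hx); specialize (Br x Hx); nra.
Qed.

Lemma tame_mult (q dq r dr : R -> R) :
  tame q dq -> tame r dr -> tame (fun x => q x * r x) (fun x => dq x * r x + q x * dr x).
Proof.
intros Tq Tr.
assert (Kq := fun x => tame_continuous q dq x Tq).
assert (Kr := fun x => tame_continuous r dr x Tr).
destruct Tq as [Hq [Cq [M [N [HM Bq]]]]], Tr as [Hr [Cr [M' [N' [HM' Br]]]]].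
split; [|split].
- intros x; apply (is_derive_mult (K := R_AbsRing)); auto; apply Rmult_comm.
- intros x; apply (continuous_plus (V := R_NormedModule));
    apply (continuous_mult (K := R_AbsRing)); auto.
- exists (M * M'), (N + N')%nat; split; [now apply Rmult_le_pos|]; intros x Hx.
  rewrite Rabs_mult, pow_add.
  replace (M * M' * (x ^ N * x ^ N')) with ((M * x ^ N) * (M' * x ^ N')) by ring.
  apply Rmult_le_compat; auto; apply Rabs_pos.
Qed.

Lemma tame_ext (q dq r dr : R -> R) :
  (forall x, q x = r x) -> (forall x, dq x = dr x) -> tame q dq -> tame r dr.
Proof.
intros E1 E2 [Hq [Cq [M [N [HM Bq]]]]]; split; [|split].
- intros x; rewrite <- E2; apply (is_derive_ext (V := R_NormedModule) q); auto.
- intros x; apply (continuous_ext dq); auto.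
- exists M, N; split; [exact HM|]; intros x Hx; rewrite <- E1; auto.
Qed.

Lemma cpoly_tame (d : nat) (a : C) (f df : C -> C) :
  cpoly d a f df ->
  tame (fun x => Re (f (RtoC x))) (fun x => Re (df (RtoC x))) /\
  tame (fun x => Im (f (RtoC x))) (fun x => Im (df (RtoC x))).
Proof.
revert f df; induction d as [|d IH]; intros f df.
- intros H; split.
  + apply (tame_ext (fun _ => Re a) (fun _ => 0)); [| |apply tame_const];
      intros x; destruct (H (RtoC x)) as [E1 E2]; rewrite ?E1, ?E2; reflexivity.
  + apply (tame_ext (fun _ => Im a) (fun _ => 0)); [| |apply tame_const];
      intros x; destruct (H (RtoC x)) as [E1 E2]; rewrite ?E1, ?E2; reflexivity.
- intros [c [g [dg [Hg H]]]]; destruct (IH g dg Hg) as [T1 T2]; split.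
  + eapply tame_ext; [| |apply tame_plus; [apply (tame_const (Re c))|
      apply tame_mult; [apply tame_id|exact T1]]];
      intros x; destruct (H (RtoC x)) as [E1 E2]; rewrite ?E1, ?E2; simpl; unfold Re; ring.
  + eapply tame_ext; [| |apply tame_plus; [apply (tame_const (Im c))|
      apply tame_mult; [apply tame_id|exact T2]]];
      intros x; destruct (H (RtoC x)) as [E1 E2]; rewrite ?E1, ?E2; simpl; unfold Re, Im; ring.
Qed.

Lemma squeeze_0 (G : (R -> Prop) -> Prop) (f g : R -> R) :
  Filter G -> G (fun x => Rabs (f x) <= g x) -> filterlim g G (locally 0) ->
  filterlim f G (locally 0).
Proof.
intros FG H Hg; apply filterlim_locally; intros eps.
apply filterlim_locally with (eps := eps) in Hg.
generalize (filter_and _ _ H Hg); apply filter_imp; intros x [H1 H2].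
change (Rabs (g x - 0) < eps) in H2; change (Rabs (f x - 0) < eps).
rewrite Rminus_0_r in *; apply Rabs_def2 in H2; lra.
Qed.

Lemma continuous_locally_bounded (f : R -> R) (x : R) :
  continuous f x -> locally x (fun y => Rabs (f y) <= Rabs (f x) + 1).
Proof.
intros H; apply filterlim_locally with (eps := mkposreal 1 Rlt_0_1) in H.
revert H; apply filter_imp; intros y Hy.
change (Rabs (f y - f x) < 1) in Hy.
replace (f y) with ((f y - f x) + f x) by ring.
apply Rle_trans with (1 := Rabs_triang _ _); lra.
Qed.

(** * Real powers on the half-line *)

Lemma rpow_ge_0 (x a : R) : 0 <= rpow x a.
Proof.
unfold rpow; destruct (Rlt_dec 0 x); [|lra].
apply Rlt_le; unfold Rpower; apply exp_pos.
Qed.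

Lemma rpow_pos (x a : R) : 0 < x -> 0 < rpow x a.
Proof.
intros H; unfold rpow; destruct (Rlt_dec 0 x); [|lra].
unfold Rpower; apply exp_pos.
Qed.

Lemma rpow_Rpower (x a : R) : 0 < x -> rpow x a = Rpower x a.
Proof.
intros H; unfold rpow; destruct (Rlt_dec 0 x); lra.
Qed.

Lemma rpow_0_l (a : R) : rpow 0 a = 0.
Proof.
unfold rpow; destruct (Rlt_dec 0 0); lra.
Qed.

Lemma rpow_le (x y a : R) : 0 < a -> x <= y -> rpow x a <= rpow y a.
Proof.
intros Ha Hxy; destruct (Rlt_dec 0 x) as [Hx|Hx].
- rewrite !rpow_Rpower by lra; apply Rle_Rpower_l; lra.
- unfold rpow at 1; destruct (Rlt_dec 0 x); [lra|apply rpow_ge_0].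
Qed.

Lemma rpow_to_0 (a : R) : 0 < a -> filterlim (fun x => rpow x a) (locally 0) (locally 0).
Proof.
intros Ha; apply filterlim_locally; intros eps.
assert (Hd : 0 < Rpower eps (/ a)) by (unfold Rpower; apply exp_pos).
exists (mkposreal _ Hd); intros x Hx.
change (Rabs (x - 0) < Rpower eps (/ a)) in Hx; change (Rabs (rpow x a - 0) < eps).
rewrite Rminus_0_r in *; rewrite Rabs_pos_eq by apply rpow_ge_0.
unfold rpow; destruct (Rlt_dec 0 x) as [H|H]; [|apply cond_pos].
rewrite Rabs_pos_eq in Hx by lra.
replace (pos eps) with (Rpower (Rpower eps (/ a)) a).
- apply Rlt_Rpower_l; lra.
- rewrite Rpower_mult, Rinv_l by lra; apply Rpower_1, cond_pos.
Qed.

(** The factor g / (x - t) absorbs the sign of x - t, so one formula serves both sides of t. *)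
Lemma rpow_is_derive (t g x : R) :
  x <> t ->
  is_derive (V := R_NormedModule) (fun y => rpow (Rabs (y - t)) g) x
    (rpow (Rabs (x - t)) g * (g / (x - t))).
Proof.
intros Hx; rewrite rpow_Rpower by (apply Rabs_pos_lt; lra).
destruct (Rtotal_order x t) as [H|[H|H]]; [|lra|].
- apply (is_derive_ext_loc (fun y => Rpower (t - y) g)).
  + generalize (open_lt t x H); apply filter_imp; intros y Hy.
    rewrite Rabs_left, rpow_Rpower by lra; f_equal; lra.
  + rewrite Rabs_left by lra; unfold Rpower; auto_derive; [lra|].
    replace (- (x - t)) with (t - x) by ring; change (t + - x) with (t - x); field; lra.
- apply (is_derive_ext_loc (fun y => Rpower (y - t) g)).
  + generalize (open_gt t x H); apply filter_imp; intros y Hy.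
    rewrite Rabs_pos_eq, rpow_Rpower by lra; reflexivity.
  + rewrite Rabs_pos_eq by lra; unfold Rpower; auto_derive; [lra|change (x + - t) with (x - t); field; lra].
Qed.

(** * The logarithmic derivative of the weight and the vanishing boundary terms *)

Section Weight.

Context (lam : R) (w0 : R -> R) (t gamma A B : R).
Let wL := w_lag lam w0.
Let dv := Derive (v_of wL).
Let w := w_sing wL t gamma A B.
Hypothesis lam_gt : -1 < lam.
Hypothesis HL : laguerre_type lam w0.
Hypothesis t_ge0 : 0 <= t.
Hypothesis gamma_gt0 : 0 < gamma.

Lemma w_lag_pos (x : R) : 0 < x -> 0 < wL x.
Proof.
intros Hx; apply Rmult_lt_0_compat; [now apply rpow_pos|now apply (lt_pos _ _ HL)].
Qed.

Lemma Derive_v_of (x : R) : 0 < x -> dv x = - (lam / x + Derive w0 x / w0 x).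
Proof.
intros Hx; apply is_derive_unique.
pose proof (lt_pos _ _ HL x Hx) as Hp; pose proof (lt_derivable _ _ HL x Hx) as Hd.
apply (is_derive_ext_loc (fun y => - (lam * ln y + ln (w0 y)))).
- generalize (open_gt 0 x Hx); apply filter_imp; intros y Hy.
  unfold v_of, wL, w_lag; rewrite rpow_Rpower by exact Hy.
  rewrite ln_mult by (try (unfold Rpower; apply exp_pos); now apply (lt_pos _ _ HL)).
  unfold Rpower; now rewrite ln_exp.
- auto_derive; [now repeat split|].
  replace (Derive (fun y => w0 y) x) with (Derive w0 x) by reflexivity; field; lra.
Qed.

Lemma w_lag_derive (x : R) :
  0 < x -> is_derive (V := R_NormedModule) wL x (- dv x * wL x).
Proof.
intros Hx; rewrite Derive_v_of by exact Hx.
pose proof (lt_pos _ _ HL x Hx) as Hp; pose proof (lt_derivable _ _ HL x Hx) as Hd.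
apply (is_derive_ext_loc (fun y => exp (lam * ln y) * w0 y)).
- generalize (open_gt 0 x Hx); apply filter_imp; intros y Hy.
  unfold wL, w_lag; now rewrite rpow_Rpower.
- unfold wL, w_lag; rewrite rpow_Rpower by exact Hx; unfold Rpower.
  auto_derive; [now repeat split|].
  replace (Derive (fun y => w0 y) x) with (Derive w0 x) by reflexivity; field; lra.
Qed.

Lemma step_locally_const (x : R) :
  x <> t -> locally x (fun y => A + B * theta (y - t) = A + B * theta (x - t)).
Proof.
intros Hx; destruct (Rlt_dec x t) as [H|H].
- generalize (open_lt t x H); apply filter_imp; intros y Hy; unfold theta.
  destruct (Rlt_dec 0 (y - t)), (Rlt_dec 0 (x - t)); lra.
- assert (H' : t < x) by lra.
  generalize (open_gt t x H'); apply filter_imp; intros y Hy; unfold theta.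
  destruct (Rlt_dec 0 (y - t)), (Rlt_dec 0 (x - t)); lra.
Qed.

(** Off t the step factor is locally constant, so only w_L and |x - t|^gamma contribute. The product
    form, in place of w' / w, also covers a stretch on which w vanishes. *)
Lemma w_sing_derive (x : R) :
  0 < x -> x <> t ->
  is_derive (V := R_NormedModule) w x (w x * (- dv x + gamma / (x - t))).
Proof.
intros Hx Hxt.
set (k := A + B * theta (x - t)).
apply (is_derive_ext_loc (fun y => k * (wL y * rpow (Rabs (y - t)) gamma))).
- generalize (step_locally_const x Hxt); apply filter_imp; intros y Hy.
  unfold w, w_sing; rewrite Hy; change (k * (wL y * rpow (Rabs (y - t)) gamma) = wL y * rpow (Rabs (y - t)) gamma * k :> R); ring.
- replace (w x * (- dv x + gamma / (x - t))) with
    (scal k (plus (mult (- dv x * wL x) (rpow (Rabs (x - t)) gamma))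
       (mult (wL x) (rpow (Rabs (x - t)) gamma * (gamma / (x - t)))))).
  + apply (is_derive_scal (fun y => wL y * rpow (Rabs (y - t)) gamma) x k).
    apply (is_derive_mult (K := R_AbsRing) wL (fun y => rpow (Rabs (y - t)) gamma)).
    * now apply w_lag_derive.
    * now apply rpow_is_derive.
    * apply Rmult_comm.
  + unfold w, w_sing, k, scal, plus, mult; simpl; unfold mult; simpl; field; lra.
Qed.

Lemma w_sing_continuous (x : R) : 0 < x -> x <> t -> continuous w x.
Proof.
intros Hx Hxt; apply (ex_derive_continuous (V := R_NormedModule)).
eexists; now apply w_sing_derive.
Qed.

Lemma log_derivative_continuous (x : R) :
  0 < x -> x <> t -> continuous (fun y => - dv y + gamma / (y - t)) x.
Proof.
intros Hx Hxt.
apply (continuous_ext_loc _ (fun y => lam / y + Derive w0 y / w0 y + gamma / (y - t))).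
- generalize (open_gt 0 x Hx); apply filter_imp; intros y Hy.
  rewrite Derive_v_of by exact Hy; unfold Rdiv; apply (f_equal (fun s => s + gamma * / (y - t))), eq_sym, Ropp_involutive.
- assert (Hw : continuous w0 x).
  { apply (ex_derive_continuous (V := R_NormedModule)), (lt_derivable _ _ HL x Hx). }
  assert (Hd : continuous (Derive w0) x) by apply (lt_C1 _ _ HL x Hx).
  assert (Hp := lt_pos _ _ HL x Hx).
  apply (continuous_plus (V := R_NormedModule)); [apply (continuous_plus (V := R_NormedModule))|].
  + apply (ex_derive_continuous (V := R_NormedModule)); auto_derive; lra.
  + apply (continuous_mult (K := R_AbsRing)); [exact Hd|].
    apply continuous_comp; [exact Hw|].
    apply (ex_derive_continuous (V := R_NormedModule)); auto_derive; lra.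
  + apply (ex_derive_continuous (V := R_NormedModule)); auto_derive; lra.
Qed.

Lemma step_bounded (y : R) : Rabs (A + B * theta (y - t)) <= Rabs A + Rabs B.
Proof.
apply Rle_trans with (1 := Rabs_triang _ _); rewrite Rabs_mult.
assert (H : Rabs (theta (y - t)) <= 1).
{ unfold theta; destruct (Rlt_dec 0 (y - t)); rewrite Rabs_pos_eq; lra. }
pose proof (Rabs_pos B); nra.
Qed.

(** Near 0 all factors but x * x^lam are bounded, with |x - t| <= t + 1, and x^(lam + 1) tends to 0
    because lam > -1. *)
Lemma boundary_at_0 (q : R -> R) :
  continuous q 0 -> filterlim (fun x => x * w x * q x) (at_right 0) (locally 0).
Proof.
intros Hq; destruct (lt_bounded _ _ HL) as [d [M [Hd HM]]].
set (K := M * rpow (t + 1) gamma * (Rabs A + Rabs B) * (Rabs (q 0) + 1)).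
apply (squeeze_0 _ _ (fun x => K * rpow x (lam + 1))); [apply at_right_proper_filter| |].
- assert (Hq' : at_right 0 (fun x => Rabs (q x) <= Rabs (q 0) + 1)).
  { apply filter_le_within with (1 := continuous_locally_bounded q 0 Hq). }
  pose proof (at_right_between 0 (Rmin d 1 / 2)) as Hb.
  assert (H0 : 0 < Rmin d 1) by (apply Rmin_glb_lt; lra).
  specialize (Hb ltac:(lra)).
  generalize (filter_and _ _ Hq' Hb); apply filter_imp; intros x [Hqx Hx].
  pose proof (Rmin_l d 1) as Hm1; pose proof (Rmin_r d 1) as Hm2.
  unfold w, w_sing, wL, w_lag, K; rewrite (rpow_Rpower x) by lra.
  rewrite (rpow_Rpower x) by lra; rewrite Rpower_plus, Rpower_1 by lra.
  rewrite !Rabs_mult, (Rabs_pos_eq x), (Rabs_pos_eq (Rpower x lam)),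
    (Rabs_pos_eq (rpow _ _)) by (try apply rpow_ge_0; try (unfold Rpower; apply Rlt_le, exp_pos); lra).
  assert (H1 : Rabs (w0 x) <= M) by (apply HM; lra).
  assert (H2 : rpow (Rabs (x - t)) gamma <= rpow (t + 1) gamma).
  { apply rpow_le; [lra|]; apply Rabs_le; lra. }
  pose proof (step_bounded x) as H3.
  replace (x * (Rpower x lam * Rabs (w0 x) * rpow (Rabs (x - t)) gamma *
      Rabs (A + B * theta (x - t))) * Rabs (q x)) with
    (Rabs (w0 x) * rpow (Rabs (x - t)) gamma * Rabs (A + B * theta (x - t)) * Rabs (q x)
      * (Rpower x lam * x)) by ring.
  apply Rmult_le_compat_r.
  { apply Rmult_le_pos; [unfold Rpower; apply Rlt_le, exp_pos|lra]. }
  pose proof (Rabs_pos (w0 x)); pose proof (Rabs_pos (A + B * theta (x - t)));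
    pose proof (Rabs_pos (q x)); pose proof (rpow_ge_0 (Rabs (x - t)) gamma).
  repeat apply Rmult_le_compat; auto; repeat apply Rmult_le_pos; auto.
- replace (locally 0) with (locally (K * 0)) by (f_equal; ring).
  apply filterlim_Rscal; [apply at_right_proper_filter|].
  eapply filterlim_filter_le_1; [apply filter_le_within|]; apply rpow_to_0; lra.
Qed.

(** The step factor may jump at t but stays bounded, and |x - t|^gamma tends to 0 since gamma > 0.
    The value at t is 0 because [rpow] is 0 at 0. *)
Lemma boundary_at_t (q : R -> R) :
  0 < t -> continuous q t -> continuous (fun x => x * w x * q x) t.
Proof.
intros Ht Hq; unfold continuous.
replace (t * w t * q t) with 0.
2:{ unfold w, w_sing; rewrite Rminus_diag, Rabs_R0, rpow_0_l; ring. }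
set (g := fun x => x * wL x * q x).
assert (Hg : continuous g t).
{ apply (continuous_mult (K := R_AbsRing)); [apply (continuous_mult (K := R_AbsRing))|exact Hq].
  - apply continuous_id.
  - apply (ex_derive_continuous (V := R_NormedModule)); eexists; now apply w_lag_derive. }
apply (squeeze_0 _ _ (fun x => (Rabs (g t) + 1) * (Rabs A + Rabs B) * rpow (Rabs (x - t)) gamma)).
- apply locally_filter.
- generalize (continuous_locally_bounded g t Hg); apply filter_imp; intros x Hx.
  replace (x * w x * q x) with
    (g x * (A + B * theta (x - t)) * rpow (Rabs (x - t)) gamma)
    by (unfold g, w, w_sing; ring).
  rewrite !Rabs_mult, (Rabs_pos_eq (rpow _ _)) by apply rpow_ge_0.
  apply Rmult_le_compat_r; [apply rpow_ge_0|].
  apply Rmult_le_compat; auto using Rabs_pos, step_bounded.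
- replace (locally 0) with (locally ((Rabs (g t) + 1) * (Rabs A + Rabs B) * 0))
    by (f_equal; ring).
  apply filterlim_Rscal; [apply locally_filter|].
  apply (filterlim_comp _ _ _ (fun x => Rabs (x - t)) (fun y => rpow y gamma) _ (locally 0)).
  + assert (Hc : continuous (fun x => Rabs (x - t)) t).
    { apply continuous_comp; [|apply continuous_Rabs].
      apply (continuous_minus (V := R_NormedModule)); [apply continuous_id|apply continuous_const]. }
    unfold continuous in Hc; now rewrite Rminus_diag, Rabs_R0 in Hc.
  + now apply rpow_to_0.
Qed.

(** Brings a monomial under the decay hypothesis, which speaks of [polyR]. *)
Lemma pow_le_polyR (d : nat) (x : R) : 0 <= x -> x ^ d <= polyR (fun _ => 1) d x.
Proof.
intros Hx; unfold polyR; destruct d as [|d]; [simpl; lra|]; rewrite tech5.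
cut (0 <= sum_f_R0 (fun k => 1 * x ^ k) d); [lra|].
apply cond_pos_sum; intros k; rewrite Rmult_1_l; now apply pow_le.
Qed.

Lemma boundary_at_infty (q dq : R -> R) :
  tame q dq -> filterlim (fun x => x * w x * q x) (Rbar_locally p_infty) (locally 0).
Proof.
intros [_ [_ [M [N [HM Bq]]]]].
(* For x > 1 + t, |x - t|^gamma <= x^n. The degree 1 + N + n collects the factor x, the growth x^N
   of q and this x^n. *)
destruct (INR_unbounded gamma) as [n Hn].
set (K := M * (Rabs A + Rabs B)).
apply (squeeze_0 _ _ (fun x => K * (wL x * polyR (fun _ => 1) (1 + N + n) x))).
- apply (Rbar_locally_filter p_infty).
- exists (1 + t); intros x Hx.
  assert (Hw := w_lag_pos x ltac:(lra)).
  assert (H1 : rpow (Rabs (x - t)) gamma <= x ^ n).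
  { rewrite Rabs_pos_eq by lra.
    apply Rle_trans with (rpow x gamma); [apply rpow_le; lra|].
    rewrite rpow_Rpower, <- Rpower_pow by lra; apply Rle_Rpower; lra. }
  assert (H2 := pow_le_polyR (1 + N + n) x ltac:(lra)).
  assert (H3 := step_bounded x); assert (H4 := Bq x ltac:(lra)).
  unfold w, w_sing; rewrite !Rabs_mult, (Rabs_pos_eq x), (Rabs_pos_eq (wL x)),
    (Rabs_pos_eq (rpow _ _)) by (try apply rpow_ge_0; lra).
  apply Rle_trans with (wL x * (x * (M * x ^ N) * x ^ n) * (Rabs A + Rabs B)).
  + replace (x * (wL x * rpow (Rabs (x - t)) gamma * Rabs (A + B * theta (x - t))) * Rabs (q x))
      with (wL x * (x * Rabs (q x) * rpow (Rabs (x - t)) gamma) * Rabs (A + B * theta (x - t)))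
      by ring.
    pose proof (Rabs_pos (q x)); pose proof (rpow_ge_0 (Rabs (x - t)) gamma).
    assert (Hx0 : 0 <= x) by lra.
    assert (0 <= x * Rabs (q x)) by (apply Rmult_le_pos; lra).
    apply Rmult_le_compat; auto using Rabs_pos.
    { apply Rmult_le_pos; [lra|now apply Rmult_le_pos]. }
    apply Rmult_le_compat_l; [lra|].
    apply Rmult_le_compat; auto.
    apply Rmult_le_compat_l; lra.
  + replace (wL x * (x * (M * x ^ N) * x ^ n) * (Rabs A + Rabs B))
      with (K * (wL x * x ^ (1 + N + n)))
      by (unfold K; rewrite !pow_add, pow_1; ring).
    apply Rmult_le_compat_l.
    * apply Rmult_le_pos; [exact HM|]; pose proof (Rabs_pos A); pose proof (Rabs_pos B); lra.
    * apply Rmult_le_compat_l; lra.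
- replace (locally 0) with (locally (K * 0)) by (f_equal; ring).
  apply filterlim_Rscal; [apply (Rbar_locally_filter p_infty)|].
  exact (lt_decay _ _ HL (fun _ => 1) (1 + N + n)%nat).
Qed.

(* The factor x kills the boundary term at 0, where w itself may be unbounded. *)
Lemma integral_derivative_zero (q dq : R -> R) :
  tame q dq ->
  has_impint (fun x => (q x + x * dq x + x * q x * (- dv x + gamma / (x - t))) * w x) 0 0.
Proof.
intros Tq; assert (Hq := fun x => tame_continuous q dq x Tq).
(* The product is itself the primitive, so convergence is obtained and not assumed. At t only its
   continuity is used, which makes t an exceptional point. *)
exists (fun x => x * w x * q x), (t :: nil), 0, 0.
assert (HD : forall x, 0 < x -> x <> t ->
  is_derive (V := R_NormedModule) (fun x => x * w x * q x) x
    ((q x + x * dq x + x * q x * (- dv x + gamma / (x - t))) * w x)).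
{ intros x Hx Hxt.
  replace ((q x + x * dq x + x * q x * (- dv x + gamma / (x - t))) * w x) with
    (plus (mult (plus (mult 1 (w x)) (mult x (w x * (- dv x + gamma / (x - t))))) (q x))
       (mult (x * w x) (dq x)))
    by (unfold plus, mult; simpl; ring).
  apply (is_derive_mult (K := R_AbsRing) (fun x => x * w x)).
  - apply (is_derive_mult (K := R_AbsRing) (fun x => x)).
    + apply (is_derive_id (K := R_AbsRing)).
    + now apply w_sing_derive.
    + apply Rmult_comm.
  - apply Tq.
  - apply Rmult_comm. }
split; [split|split; [|split]].
- intros x Hx; destruct (Req_dec x t) as [->|Hxt].
  + now apply boundary_at_t.
  + apply (ex_derive_continuous (V := R_NormedModule)); eexists; now apply HD.
- intros u v Hu Huv Hcl.
  assert (Hne : forall x, Rmin u v <= x <= Rmax u v -> 0 < x /\ x <> t).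
  { rewrite Rmin_left, Rmax_right by lra; intros x Hx; split; [lra|]; intros ->.
    apply (Hcl t); [now left|exact Hx]. }
  apply (is_RInt_derive (V := R_CompleteNormedModule) (fun x => x * w x * q x)).
  + intros x Hx; destruct (Hne x Hx); now apply HD.
  + intros x Hx; destruct (Hne x Hx) as [Hx0 Hxt].
    apply (continuous_mult (K := R_AbsRing)); [|now apply w_sing_continuous].
    apply (continuous_plus (V := R_NormedModule)).
    * apply (continuous_plus (V := R_NormedModule)); [apply Hq|].
      apply (continuous_mult (K := R_AbsRing)); [apply continuous_id|apply Tq].
    * apply (continuous_mult (K := R_AbsRing)).
      -- apply (continuous_mult (K := R_AbsRing)); [apply continuous_id|apply Hq].
      -- now apply log_derivative_continuous.
- now apply boundary_at_0.
- now apply (boundary_at_infty q dq).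
- ring.
Qed.

End Weight.

(** * Orthogonality, the kernel and the ladder identity *)

Definition ctame (f df : C -> C) : Prop :=
  tame (fun x => Re (f (RtoC x))) (fun x => Re (df (RtoC x))) /\
  tame (fun x => Im (f (RtoC x))) (fun x => Im (df (RtoC x))).

Lemma ctame_mult (f df g dg : C -> C) :
  ctame f df -> ctame g dg ->
  ctame (fun x => (f x * g x)%C) (fun x => (df x * g x + f x * dg x)%C).
Proof.
intros [F1 F2] [G1 G2]; split.
- eapply tame_ext; [| |apply tame_plus; [apply (tame_mult _ _ _ _ F1 G1)|
    apply tame_mult; [apply (tame_const (-1))|apply (tame_mult _ _ _ _ F2 G2)]]];
    intros x; simpl; unfold Re, Im; ring.
- eapply tame_ext; [| |apply tame_plus; [apply (tame_mult _ _ _ _ F1 G2)|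
    apply (tame_mult _ _ _ _ F2 G1)]];
    intros x; simpl; unfold Re, Im; ring.
Qed.

(** With the single exceptional point Re z, division by z - x is legitimate for every complex z,
    real or not. *)
Lemma C_nonzero_Re (z : C) (x : R) : x <> Re z -> (z - RtoC x)%C <> 0%C.
Proof.
intros Hx H; apply Hx; apply (f_equal Re) in H; simpl in H; unfold Re in *; lra.
Qed.

(** A relation and not a value, so that every moment carries its convergence along. *)
Definition moment (w : R -> R) (f : C -> C) (l : C) : Prop :=
  has_impintC (fun x => (f (RtoC x) * RtoC (w x))%C) l.

Lemma moment_ext (w : R -> R) (f g : C -> C) (l : C) :
  (forall x, f x = g x) -> moment w f l -> moment w g l.
Proof.
intros E; apply (has_impintC_ext nil); intros x _ _; now rewrite E.
Qed.

Lemma moment_plus (w : R -> R) (f g : C -> C) (l m : C) :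
  moment w f l -> moment w g m -> moment w (fun x => (f x + g x)%C) (l + m)%C.
Proof.
intros Hf Hg; generalize (has_impintC_plus _ _ _ _ Hf Hg).
apply (has_impintC_ext nil); intros x _ _; ring.
Qed.

Lemma moment_scal (w : R -> R) (k : C) (f : C -> C) (l : C) :
  moment w f l -> moment w (fun x => (k * f x)%C) (k * l)%C.
Proof.
intros Hf; generalize (has_impintC_scal _ k _ Hf).
apply (has_impintC_ext nil); intros x _ _; ring.
Qed.

Section Orthogonal.

Context (w : R -> R) (P : nat -> nat -> R) (h : nat -> R).
Hypothesis HP : monic_orthogonal w P h.

Lemma pC_cpoly (n : nat) : exists dP, cpoly n 1%C (pC P n) dP.
Proof.
destruct (polyC_cpoly (P n) n) as [dP H]; exists dP.
destruct HP as [H1 _]; now rewrite H1 in H.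
Qed.

Lemma moment_orthogonal (i j : nat) :
  moment w (fun x => (pC P i x * pC P j x)%C) (if Nat.eq_dec i j then RtoC (h j) else 0%C).
Proof.
replace (if Nat.eq_dec i j then RtoC (h j) else 0%C) with
  (RtoC (if Nat.eq_dec i j then h j else 0)) by (destruct (Nat.eq_dec i j); reflexivity).
generalize (has_impintC_RtoC _ _ (is_impint_has_impint _ _ _ (proj2 HP i j))).
apply (has_impintC_ext nil); intros x _ _.
unfold pC; rewrite !polyC_RtoC, !RtoC_mult; reflexivity.
Qed.

(** Subtracting a P_d from f lowers the degree bound, and the subtracted term contributes only when
    d = e. *)
Lemma moment_cpoly (d e : nat) (a : C) (f df : C -> C) :
  cpoly d a f df -> (d <= e)%nat ->
  moment w (fun x => (f x * pC P e x)%C) (if Nat.eq_dec d e then (a * RtoC (h e))%C else 0%C).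
Proof.
revert a f df; induction d as [|d IH]; intros a f df Hf Hde.
- replace (if Nat.eq_dec 0 e then (a * RtoC (h e))%C else 0%C) with
    (a * (if Nat.eq_dec 0 e then RtoC (h e) else 0))%C
    by (destruct (Nat.eq_dec 0 e); ring).
  apply (moment_ext w (fun x => (a * (pC P 0 x * pC P e x))%C)).
  + intros x; destruct (Hf x) as [-> _]; unfold pC at 1, polyC; rewrite sum_O.
    rewrite (proj1 HP 0%nat); simpl; ring.
  + apply moment_scal, moment_orthogonal.
- destruct (pC_cpoly (S d)) as [dP HdP].
  destruct (cpoly_drop d (fun x => (f x + - a * pC P (S d) x)%C) (fun x => (df x + - a * dP x)%C))
    as [b Hb].
  { replace (RtoC 0) with (a + - a * 1)%C by ring.
    apply cpoly_plus; [exact Hf|now apply cpoly_scal]. }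
  replace (if Nat.eq_dec (S d) e then (a * RtoC (h e))%C else 0%C) with
    ((if Nat.eq_dec d e then (b * RtoC (h e))%C else 0%C) +
     a * (if Nat.eq_dec (S d) e then RtoC (h e) else 0))%C.
  2:{ destruct (Nat.eq_dec d e); [lia|]; destruct (Nat.eq_dec (S d) e); ring. }
  eapply moment_ext; [|apply moment_plus;
    [apply (IH b _ _ Hb); lia|apply moment_scal, (moment_orthogonal (S d) e)]].
  intros x; simpl; ring.
Qed.

Lemma moment_cpoly_lt (d e : nat) (a : C) (f df : C -> C) :
  cpoly d a f df -> (d < e)%nat -> moment w (fun x => (f x * pC P e x)%C) 0%C.
Proof.
intros Hf Hde; generalize (moment_cpoly d e a f df Hf ltac:(lia)).
destruct (Nat.eq_dec d e); [lia|auto].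
Qed.

Lemma moment_cpoly_eq (d : nat) (a : C) (f df : C -> C) :
  cpoly d a f df -> moment w (fun x => (f x * pC P d x)%C) (a * RtoC (h d))%C.
Proof.
intros Hf; generalize (moment_cpoly d d a f df Hf ltac:(lia)).
destruct (Nat.eq_dec d d); [auto|lia].
Qed.

(* Up to the factor h_m, K is the Christoffel-Darboux kernel of order m. *)
Definition is_kernel (m : nat) (z : C) (K dK : C -> C) : Prop :=
  cpoly m (pC P m z) K dK /\
  (forall x, K x * (z - x) = pC P (S m) z * pC P m x - pC P m z * pC P (S m) x)%C /\
  moment w K (RtoC (h m)).

(** K is P_m(z) D_n - P_n(z) D_m, with n = m + 1 and D_n, D_m the divided differences of P_n, P_m.
    Expanding P_m(z) and P_n(z) around x turns it into D_n P_m - D_m P_n, whose integral is h_m: D_n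
    is monic of degree m, and D_m P_n integrates to 0. *)
Lemma kernel_exists (m : nat) (z : C) : exists K dK, is_kernel m z K dK.
Proof.
destruct (pC_cpoly (S m)) as [dPn Hn]; destruct (pC_cpoly m) as [dPm Hm].
destruct (cpoly_divided_difference m 1%C z _ _ Hn) as [Dn [dDn [HDn En]]].
destruct (cpoly_divided_difference0 m 1%C z _ _ Hm) as [Dm [dDm [HDm Em]]].
set (a := pC P m z); set (b := pC P (S m) z).
exists (fun x => (a * Dn x + - b * Dm x)%C), (fun x => (a * dDn x + - b * dDm x)%C).
split; [|split].
- replace (pC P m z) with (a * 1 + - b * 0)%C by (unfold a; ring).
  apply cpoly_plus; now apply cpoly_scal.
- intros x.
  replace ((a * Dn x + - b * Dm x) * (z - x))%C with
    (a * (Dn x * (z - x)) - b * (Dm x * (z - x)))%C by ring.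
  rewrite En, Em; unfold a, b; ring.
- apply (moment_ext w (fun x => (Dn x * pC P m x + (-1) * (Dm x * pC P (S m) x))%C)).
  + intros x.
    assert (Ea : a = (pC P m x + Dm x * (z - x))%C) by (rewrite Em; unfold a; ring).
    assert (Eb : b = (pC P (S m) x + Dn x * (z - x))%C) by (rewrite En; unfold b; ring).
    rewrite Ea, Eb; ring.
  + replace (RtoC (h m)) with (1 * RtoC (h m) + (-1) * 0)%C by ring.
    apply moment_plus; [exact (moment_cpoly_eq m _ _ _ HDn)|].
    apply moment_scal, (moment_cpoly_lt m (S m) 0%C _ _ HDm); lia.
Qed.

Lemma kernel_reproducing (m : nat) (z a : C) (K dK p dp : C -> C) :
  is_kernel m z K dK -> cpoly m a p dp ->
  moment w (fun x => (p x * K x)%C) (RtoC (h m) * p z)%C.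
Proof.
intros [_ [EK HK]] Hp.
(* Top coefficient 0 in degree m makes D orthogonal to P_m as well as to P_(m+1). *)
destruct (cpoly_divided_difference0 m a z _ _ Hp) as [D [dD [HD ED]]].
apply (moment_ext w (fun x => (p z * K x +
  (- pC P (S m) z * (D x * pC P m x) + pC P m z * (D x * pC P (S m) x)))%C)).
- intros x.
  transitivity (p z * K x - D x * (K x * (z - x)))%C; [rewrite EK; ring|].
  transitivity (p z * K x - (D x * (z - x)) * K x)%C; [ring|rewrite ED; ring].
- replace (RtoC (h m) * p z)%C with (p z * RtoC (h m) +
    (- pC P (S m) z * (0 * RtoC (h m)) + pC P m z * 0))%C by ring.
  apply moment_plus; [now apply moment_scal|apply moment_plus; apply moment_scal].
  + exact (moment_cpoly_eq m _ _ _ HD).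
  + apply (moment_cpoly_lt m (S m) 0%C _ _ HD); lia.
Qed.

(* The polynomial part of the derivative of x p K w, up to the term k p K. *)
Definition euler_part (p dp K dK : C -> C) (k : C) (x : C) : C :=
  (x * dp x * K x + p x * (K x + x * dK x) - k * (p x * K x))%C.

Lemma kernel_shift_cpoly (m : nat) (a k : C) (K dK : C -> C) :
  cpoly m a K dK ->
  exists dG, cpoly m (a * (1 + RtoC (INR m) - k))%C
    (fun x => (K x + x * dK x - k * K x)%C) dG.
Proof.
intros HK; destruct (cpoly_euler m a K dK HK) as [ddK HdK].
exists (fun x => ((1 - k) * dK x + ddK x)%C).
apply (cpoly_ext m _ (fun x => ((1 - k) * K x + x * dK x)%C)
  (fun x => ((1 - k) * dK x + ddK x)%C)); [intros x; ring|reflexivity|].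
replace (a * (1 + RtoC (INR m) - k))%C with ((1 - k) * a + RtoC (INR m) * a)%C by ring.
apply cpoly_plus; [now apply cpoly_scal|exact HdK].
Qed.

(** P_n with n = m + 1 is one degree too high for K to reproduce. Subtracting n P_n from x P_n'
    brings the degree down to m; the compensating term n K joins the cofactor of P_n, which has
    degree at most m and is orthogonal to P_n. *)
Lemma euler_moment_S (m : nat) (z k : C) (K dK dP : C -> C) :
  is_kernel m z K dK -> cpoly (S m) 1%C (pC P (S m)) dP ->
  moment w (euler_part (pC P (S m)) dP K dK k)
    (RtoC (h m) * (z * dP z - RtoC (INR (S m)) * pC P (S m) z))%C.
Proof.
intros HK HdP; set (n := RtoC (INR (S m))).
destruct (cpoly_euler _ _ _ _ HdP) as [ddP HE].
destruct (cpoly_drop m (fun x => (x * dP x + - n * pC P (S m) x)%C)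
   (fun x => (ddP x + - n * dP x)%C)) as [b Hb].
{ replace (RtoC 0) with (n * 1 + - n * 1)%C by ring.
  apply cpoly_plus; [exact HE|now apply cpoly_scal]. }
destruct (kernel_shift_cpoly m _ (k - n)%C K dK (proj1 HK)) as [dG HG].
apply (moment_ext w (fun x => ((x * dP x + - n * pC P (S m) x) * K x +
   (K x + x * dK x - (k - n) * K x) * pC P (S m) x)%C)).
- intros x; unfold euler_part; ring.
- replace (RtoC (h m) * (z * dP z - n * pC P (S m) z))%C with
    (RtoC (h m) * (z * dP z + - n * pC P (S m) z) + 0)%C by ring.
  apply moment_plus.
  + exact (kernel_reproducing m z b K dK _ _ HK Hb).
  + apply (moment_cpoly_lt m (S m) _ _ _ HG); lia.
Qed.

(** Here x P_m' is reproduced directly, while K + x K' - k K meets P_m in its own degree and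
    contributes through its top coefficient P_m(z) (1 + m - k). *)
Lemma euler_moment (m : nat) (z k : C) (K dK dP : C -> C) :
  is_kernel m z K dK -> cpoly m 1%C (pC P m) dP ->
  moment w (euler_part (pC P m) dP K dK k)
    (RtoC (h m) * (z * dP z + (RtoC (INR (S m)) - k) * pC P m z))%C.
Proof.
intros HK HdP.
destruct (cpoly_euler _ _ _ _ HdP) as [ddP HE].
destruct (kernel_shift_cpoly m _ k K dK (proj1 HK)) as [dG HG].
apply (moment_ext w (fun x => ((x * dP x) * K x +
   (K x + x * dK x - k * K x) * pC P m x)%C)).
- intros x; unfold euler_part; ring.
- replace (RtoC (h m) * (z * dP z + (RtoC (INR (S m)) - k) * pC P m z))%C with
    (RtoC (h m) * (z * dP z) + pC P m z * (1 + RtoC (INR m) - k) * RtoC (h m))%C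
    by (rewrite S_INR, RtoC_plus; ring).
  apply moment_plus.
  + exact (kernel_reproducing m z _ K dK _ _ HK HE).
  + exact (moment_cpoly_eq m _ _ _ HG).
Qed.

End Orthogonal.

(** * Nonvanishing norms and the integrated identity behind both relations *)

Section Ladder.

Context (lam : R) (w0 : R -> R) (t gamma A B : R) (P : nat -> nat -> R) (h : nat -> R).
Let wL := w_lag lam w0.
Let dv := Derive (v_of wL).
Let w := w_sing wL t gamma A B.
Hypothesis lam_gt : -1 < lam.
Hypothesis HL : laguerre_type lam w0.
Hypothesis t_ge0 : 0 <= t.
Hypothesis gamma_gt0 : 0 < gamma.
Hypothesis Hw : weight_admissible w.
Hypothesis HP : monic_orthogonal w P h.

Lemma null_set_empty (E : R -> Prop) : (forall x, ~ E x) -> null_set E.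
Proof.
intros H eps; exists (fun _ => 0), (fun _ => 0); split; [|split].
- intros _; lra.
- intros x Hx; now destruct (H x).
- exists 0; split; [|apply Rlt_le, cond_pos].
  apply (filterlim_ext (fun _ => 0)).
  + intros n; induction n as [|n IH].
    * rewrite sum_O; ring.
    * rewrite sum_Sn, <- IH; unfold plus; simpl; ring.
  + apply filterlim_const.
Qed.

(** Off t, the sign of w on the open half-line is that of A before t and of A + B after t. If
    neither gives a nonempty interval of positivity, the positive set is empty, hence null. *)
Lemma weight_positive_interval :
  exists u v, 0 <= u < v /\ forall x, u < x < v -> x <> t /\ 0 < w x.
Proof.
assert (Hpos : forall x, 0 < x -> x <> t -> 0 < A + B * theta (x - t) -> 0 < w x).
{ intros x Hx Hxt H; unfold w, w_sing; apply Rmult_lt_0_compat; [|exact H].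
  apply Rmult_lt_0_compat; [now apply w_lag_pos|apply rpow_pos, Rabs_pos_lt; lra]. }
destruct (Rlt_dec 0 (A + B)) as [H1|H1].
{ exists t, (t + 1); split; [lra|]; intros x Hx; split; [lra|]; apply Hpos; try lra.
  unfold theta; destruct (Rlt_dec 0 (x - t)); lra. }
destruct (Rlt_dec 0 t) as [Ht|Ht], (Rlt_dec 0 A) as [HA|HA].
{ exists 0, t; split; [lra|]; intros x Hx; split; [lra|]; apply Hpos; try lra.
  unfold theta; destruct (Rlt_dec 0 (x - t)); lra. }
all: exfalso; apply (proj2 Hw), null_set_empty; intros x [Hx Hwx].
(* At t, and below at 0, the weight is 0 because [rpow] vanishes at 0. *)
all: destruct (Req_dec x t) as [->|Hxt];
  [unfold w, w_sing in Hwx; rewrite Rminus_diag, Rabs_R0, rpow_0_l in Hwx; lra|].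
all: destruct (Req_dec x 0) as [->|Hx0];
  [unfold w, w_sing, wL, w_lag in Hwx; rewrite rpow_0_l in Hwx; lra|].
all: assert (H2 : 0 < wL x * rpow (Rabs (x - t)) gamma)
  by (apply Rmult_lt_0_compat; [apply w_lag_pos; auto; lra|apply rpow_pos, Rabs_pos_lt; lra]).
all: unfold w, w_sing in Hwx.
all: assert (H3 : A + B * theta (x - t) <= 0)
  by (unfold theta; destruct (Rlt_dec 0 (x - t)); lra).
all: nra.
Qed.

(** If h_n were 0, the nonnegative P_n^2 w would vanish at its points of continuity off a finite
    set, so P_n would vanish on an interval up to finitely many points, against its top coefficient
    1. *)
Lemma norm_nonzero (n : nat) : h n <> 0.
Proof.
intros H0.
pose proof (is_impint_has_impint _ _ _ (proj2 HP n n)) as Hn.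
destruct (Nat.eq_dec n n) as [_|]; [|lia]; rewrite H0 in Hn.
destruct (fun H => has_impint_zero_nonneg _ _ H Hn) as [S HS].
{ intros x Hx; apply Rmult_le_pos; [apply Rle_0_sqr|apply (proj1 Hw); lra]. }
destruct weight_positive_interval as [u [v [Huv Hp]]].
destruct (pC_cpoly w P h HP n) as [dP HdP].
assert (E : RtoC 1 = RtoC 0).
{ apply (cpoly_zero_on_interval n 1%C (pC P n) dP S u v HdP); [lra|].
  intros x Hx Hin; destruct (Hp x Hx) as [Hxt Hwx].
  unfold pC; rewrite polyC_RtoC; fold (pR P n); f_equal.
  assert (Hc : continuous (pR P n) x).
  { apply (continuous_ext (fun y => Re (pC P n (RtoC y)))).
    - intros y; unfold pC; now rewrite polyC_RtoC.
    - exact (tame_continuous _ _ x (proj1 (cpoly_tame _ _ _ _ HdP))). }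
  assert (E : pR P n x * pR P n x * w x = 0).
  { apply (HS x); [lra|exact Hin|].
    apply (continuous_mult (K := R_AbsRing)); [now apply (continuous_mult (K := R_AbsRing))|].
    apply (w_sing_continuous lam w0 t gamma A B HL); [lra|exact Hxt]. }
  apply Rmult_integral in E; destruct E as [E|E]; [|lra].
  apply Rmult_integral in E; tauto. }
apply RtoC_inj in E; lra.
Qed.

Lemma integral_derivative_zeroC (f df : C -> C) :
  ctame f df ->
  has_impintC (fun x => ((f (RtoC x) + RtoC x * df (RtoC x)
     + RtoC x * f (RtoC x) * RtoC (- dv x + gamma / (x - t))) * RtoC (w x))%C) 0%C.
Proof.
intros [T1 T2]; split.
- generalize (integral_derivative_zero lam w0 t gamma A B lam_gt HL t_ge0 gamma_gt0 _ _ T1).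
  apply (has_impint_ext nil); intros x _ _; fold wL; fold dv; fold w.
  simpl; unfold Re, Im; ring.
- generalize (integral_derivative_zero lam w0 t gamma A B lam_gt HL t_ge0 gamma_gt0 _ _ T2).
  apply (has_impint_ext nil); intros x _ _; fold wL; fold dv; fold w.
  simpl; unfold Re, Im; ring.
Qed.

(** The vanishing integral of (x P_i K w)', split up. Writing x v_L'(x) as z v_L'(z) minus z - x
    times the difference quotient leaves k = z v_L'(z) in [euler_part], and (z - x) K is a
    combination of P_m and P_(m+1). The cases i = m + 1 and i = m give the two relations. *)
Lemma ladder_identity (m i : nat) (z dvz L Q1 Q2 c1 c2 : C) (p1 p2 : R) (K dK dP : C -> C) :
  is_kernel w P h m z K dK ->
  cpoly i 1%C (pC P i) dP ->
  moment w (euler_part (pC P i) dP K dK (z * dvz)%C) L ->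
  has_impintC (quot_integrand dv w P z dvz i m) Q1 ->
  has_impintC (quot_integrand dv w P z dvz i (S m)) Q2 ->
  has_impint (pole_integrand t w P i m) 0 p1 ->
  has_impint (pole_integrand t w P i (S m)) 0 p2 ->
  has_impintC (cauchy_integrand t w P z i m) c1 ->
  has_impintC (cauchy_integrand t w P z i (S m)) c2 ->
  (L + pC P (S m) z * (Q1 + RtoC gamma * (z * c1 - RtoC p1))
   - pC P m z * (Q2 + RtoC gamma * (z * c2 - RtoC p2)))%C = 0%C.
Proof.
intros [HK [EK _]] HdP HLm HQ1 HQ2 Hp1 Hp2 Hc1 Hc2.
set (a := pC P m z) in *; set (b := pC P (S m) z) in *; set (g := RtoC gamma).
apply has_impintC_RtoC in Hp1; apply has_impintC_RtoC in Hp2.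
apply (has_impintC_unique _ _ _) with (2 := integral_derivative_zeroC _ _
  (ctame_mult _ _ _ _ (cpoly_tame _ _ _ _ HdP) (cpoly_tame _ _ _ _ HK))).
replace (L + b * (Q1 + g * (z * c1 - RtoC p1)) - a * (Q2 + g * (z * c2 - RtoC p2)))%C
  with (L + (b * Q1 + (- a * Q2 + ((b * g * z) * c1 + ((- b * g) * RtoC p1 +
     ((- a * g * z) * c2 + (a * g) * RtoC p2))))))%C by ring.
eapply has_impintC_ext;
  [|repeat (apply has_impintC_plus; [first [exact HLm|apply has_impintC_scal; eassumption]|]);
    apply has_impintC_scal; eassumption].
(* The pointwise identity divides by x - t and z - x, hence these exceptional points. *)
Unshelve. 2: exact (t :: Re z :: nil).
intros x Hx Hin; simpl in Hin.
assert (Hxt : x <> t) by (intros ->; tauto).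
assert (Hxz : (z - RtoC x)%C <> 0%C) by (apply C_nonzero_Re; intros ->; tauto).
assert (Hxt' : (RtoC x - RtoC t)%C <> 0%C)
  by (rewrite <- RtoC_minus; intros H; apply RtoC_inj in H; lra).
assert (EKx : K (RtoC x) = ((b * pC P m (RtoC x) - a * pC P (S m) (RtoC x)) / (z - RtoC x))%C)
  by (rewrite <- EK; field; exact Hxz).
unfold quot_integrand, pole_integrand, cauchy_integrand, euler_part, pR.
rewrite EKx; unfold pC; rewrite !polyC_RtoC.
unfold Rdiv; rewrite !RtoC_mult, RtoC_plus, RtoC_mult, RtoC_opp, RtoC_inv, !RtoC_minus by lra.
unfold g; field; now split.
Qed.

End Ladder.

(** * Analytic continuation of v_L' for the Laguerre weight *)

Definition pser (b : nat -> C) (r : R) (f : C -> C) : Prop :=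
  forall u, Cmod u < r -> is_pseries (K := C_AbsRing) (V := C_NormedModule) b u (f u).

Lemma pow_n_Cpow (z : C) (k : nat) : pow_n (K := C_Ring) z k = (z ^ k)%C.
Proof. induction k as [|k IH]; simpl; [reflexivity|now rewrite IH]. Qed.

Lemma pser_plus (a b : nat -> C) (r : R) (f g : C -> C) :
  pser a r f -> pser b r g -> pser (fun k => (a k + b k)%C) r (fun u => (f u + g u)%C).
Proof.
intros Hf Hg u Hu; exact (is_pseries_plus (K := C_AbsRing) (V := C_NormedModule) a b u _ _ (Hf u Hu) (Hg u Hu)).
Qed.

Lemma pser_scal (a : nat -> C) (r : R) (f : C -> C) (c : C) :
  pser a r f -> pser (fun k => (c * a k)%C) r (fun u => (c * f u)%C).
Proof.
intros Hf u Hu.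
exact (is_pseries_scal (K := C_AbsRing) (V := C_NormedModule) c a u _ (Cmult_comm u c) (Hf u Hu)).
Qed.

Lemma pser_mulX (a : nat -> C) (r : R) (f : C -> C) :
  pser a r f -> pser (PS_incr_1 (V := C_NormedModule) a) r (fun u => (u * f u)%C).
Proof.
intros Hf u Hu.
exact (is_pseries_incr_1 (K := C_AbsRing) (V := C_NormedModule) a u _ (Hf u Hu)).
Qed.

Lemma pser_const (c : C) (r : R) :
  pser (fun k => match k with O => c | _ => RtoC 0 end) r (fun _ => c).
Proof.
intros u _; unfold is_pseries, is_series.
apply (filterlim_ext (fun _ => c)); [|apply filterlim_const].
intros n; induction n as [|n IH].
- rewrite sum_O; unfold scal; simpl; unfold mult, one; simpl; ring.
- rewrite sum_Sn, <- IH; unfold plus, scal; simpl; unfold mult; simpl; ring.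
Qed.

(** Convergence at rho = r / 2 bounds the partial sums by M, and a term is a difference of two of
    them; the added 1 keeps the bound positive. *)
Lemma pser_terms_bounded (b : nat -> C) (r : R) (f : C -> C) :
  0 < r -> pser b r f ->
  exists rho M, 0 < rho < r /\ 0 < M /\ forall k, Cmod (b k) * rho ^ k <= M.
Proof.
intros Hr Hf; set (rho := r / 2).
assert (Hrho : Cmod (RtoC rho) = rho) by (rewrite Cmod_R, Rabs_pos_eq; unfold rho; lra).
assert (Hs := Hf (RtoC rho)); rewrite Hrho in Hs; specialize (Hs ltac:(unfold rho; lra)).
destruct (filterlim_bounded (K := C_AbsRing) (V := C_NormedModule) _ (ex_intro _ _ Hs)) as [M HM].
exists rho, (2 * Rabs M + 1); split; [unfold rho; lra|split; [pose proof (Rabs_pos M); lra|]].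
intros k.
assert (E : Cmod (b k) * rho ^ k = Cmod (scal (K := C_Ring) (V := C_ModuleSpace) (pow_n (K := C_Ring) (RtoC rho) k) (b k))).
{ unfold scal; simpl; unfold mult; simpl.
  rewrite Cmod_mult, pow_n_Cpow, Cmod_pow, Hrho; ring. }
rewrite E; pose proof (Rle_abs M); pose proof (Rabs_pos M).
destruct k as [|k].
- specialize (HM O); rewrite sum_O in HM; change (Cmod (scal (K := C_Ring) (V := C_ModuleSpace) (pow_n (K := C_Ring) (RtoC rho) 0) (b 0%nat)) <= M) in HM.
  lra.
- pose proof (HM k) as H1; pose proof (HM (S k)) as H2; rewrite sum_Sn in H2.
  set (s := sum_n _ k) in *; set (T := scal _ _).
  change (Cmod s <= M) in H1; change (Cmod (s + T)%C <= M) in H2.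
  replace T with ((s + T) + - s)%C by ring.
  apply Rle_trans with (1 := Cmod_triangle _ _); rewrite Cmod_opp; lra.
Qed.

(** For |u| < rho / 2 the terms after b_0 are dominated by M (|u| / rho) 2^(-k), whose sum is (2 M /
    rho) |u|. *)
Lemma pser_lipschitz (b : nat -> C) (r : R) (f : C -> C) :
  0 < r -> pser b r f ->
  exists s M, 0 < s <= r /\ 0 < M /\
    forall u, Cmod u < s -> Cmod (f u - b O)%C <= M * Cmod u.
Proof.
intros Hr Hf; destruct (pser_terms_bounded b r f Hr Hf) as [rho [M [Hrho [HM Hb]]]].
exists (rho / 2), (2 * M / rho); split; [lra|split; [apply Rdiv_lt_0_compat; lra|]].
intros u Hu; set (T := fun k => scal (K := C_Ring) (V := C_ModuleSpace) (pow_n (K := C_Ring) u k) (b k)).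
set (x := Cmod u) in *.
assert (Hx : 0 <= x) by apply Cmod_ge_0.
assert (Hur : x < r) by lra.
assert (HT : forall k, Cmod (T (S k)) <= M * (x / rho) * (/ 2) ^ k).
{ intros k; unfold T, scal; simpl; unfold mult; simpl.
  change (Cmod (u * pow_n (K := C_Ring) u k * b (S k))%C <= M * (x / rho) * (/ 2) ^ k).
  rewrite !Cmod_mult, pow_n_Cpow, Cmod_pow; fold x.
  assert (H1 := Hb (S k)).
  assert (Hp : 0 < rho ^ S k) by (apply pow_lt; lra).
  assert (H2 : Cmod (b (S k)) <= M / rho ^ S k).
  { apply (Rmult_le_reg_r (rho ^ S k)); [exact Hp|].
    unfold Rdiv; rewrite Rmult_assoc, Rinv_l, Rmult_1_r; lra. }
  apply Rle_trans with (x * x ^ k * (M / rho ^ S k)).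
  { apply Rmult_le_compat_l; [|exact H2]; apply Rmult_le_pos; [exact Hx|now apply pow_le]. }
  replace (x * x ^ k * (M / rho ^ S k)) with (M * (x / rho) * (x / rho) ^ k).
  2:{ unfold Rdiv; rewrite Rpow_mult_distr, pow_inv; simpl; field; split; [apply pow_nonzero|]; lra. }
  apply Rmult_le_compat_l.
  { apply Rmult_le_pos; [lra|]; apply Rdiv_le_0_compat; lra. }
  apply pow_incr; split; [apply Rdiv_le_0_compat; lra|].
  apply (Rmult_le_reg_r rho); [lra|]; unfold Rdiv; rewrite Rmult_assoc, Rinv_l; lra. }
assert (HS : forall n, Cmod (sum_n (G := C_AbelianMonoid) T n - b O)%C <= 2 * M / rho * x).
(* The exact partial sum of the geometric majorant is what the induction preserves. *)
{ intros n; apply Rle_trans with (2 * M / rho * x * (1 - (/ 2) ^ n)).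
  - induction n as [|n IH].
    + rewrite sum_O; replace (T O - b O)%C with (RtoC 0).
      * rewrite Cmod_0; simpl; lra.
      * unfold T, scal; simpl; unfold mult, one; simpl; ring.
    + rewrite sum_Sn; change (plus (sum_n (G := C_AbelianMonoid) T n) (T (S n)))
        with (sum_n (G := C_AbelianMonoid) T n + T (S n))%C.
      replace (sum_n (G := C_AbelianMonoid) T n + T (S n) - b O)%C with
        ((sum_n (G := C_AbelianMonoid) T n - b O) + T (S n))%C by ring.
      apply Rle_trans with (1 := Cmod_triangle _ _).
      apply Rle_trans with (1 := Rplus_le_compat _ _ _ _ IH (HT n)).
      right; simpl; field; lra.
  - rewrite <- (Rmult_1_r (2 * M / rho * x)) at 2; apply Rmult_le_compat_l.
    + apply Rmult_le_pos; [apply Rdiv_le_0_compat; lra|exact Hx].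
    + assert (H : 0 < (/ 2) ^ n) by (apply pow_lt; lra); lra. }
assert (Hl : filterlim (fun n => norm (K := C_AbsRing) (V := C_NormedModule)
    (minus (sum_n (G := C_AbelianMonoid) T n) (b O))) eventually (locally (Cmod (f u - b O)%C))).
{ apply (filterlim_comp _ _ _ _ (norm (K := C_AbsRing) (V := C_NormedModule)) _
    (locally (T := C_NormedModule) (minus (f u : C_NormedModule) (b O)))).
  - apply (filterlim_comp_2 (H := locally (T := C_NormedModule) (opp (b O : C_NormedModule))) _ _ plus (Hf u Hur)).
    + apply filterlim_const.
    + apply (filterlim_plus (K := C_AbsRing) (V := C_NormedModule)).
  - apply (filterlim_norm (K := C_AbsRing) (V := C_NormedModule)). }
apply (filterlim_le (F := eventually) _ (fun _ => 2 * M / rho * x) (Cmod (f u - b O)%C) (2 * M / rho * x)) with (2 := Hl).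
- exists O; intros n _; apply HS.
- apply filterlim_const.
Qed.

Lemma pser_divX (b : nat -> C) (r : R) (f : C -> C) :
  pser b r f -> b O = RtoC 0 ->
  exists g, pser (fun k => b (S k)) r g /\ forall u, Cmod u < r -> f u = (u * g u)%C.
Proof.
intros Hf H0.
set (g := fun u => if Ceq_dec u (RtoC 0) then b 1%nat else (/ u * f u)%C).
exists g; split.
- intros u Hu; unfold g; destruct (Ceq_dec u (RtoC 0)) as [->|Hne].
  + exact (is_pseries_0 (K := C_AbsRing) (V := C_NormedModule) (fun k => b (S k))).
  + assert (H := is_pseries_decr_1 (K := C_AbsRing) (V := C_NormedModule) b u (/ u)%C (f u)
      (Cinv_l u Hne) (Hf u Hu)).
    replace (/ u * f u)%C with (scal (K := C_Ring) (V := C_ModuleSpace) (/ u)%C (plus (f u) (opp (b O : C_ModuleSpace)))).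
    * exact H.
    * rewrite H0; unfold scal, plus, opp; simpl; unfold mult; simpl; ring.
- intros u Hu; unfold g; destruct (Ceq_dec u (RtoC 0)) as [->|Hne].
  + assert (Hz := is_pseries_0 (K := C_AbsRing) (V := C_NormedModule) b).
    assert (E : f (RtoC 0) = b O).
    { apply (filterlim_locally_unique (K := C_AbsRing) (V := C_NormedModule) (F := eventually) _ _ _ (Hf _ Hu) Hz). }
    rewrite E, H0; ring.
  + now field.
Qed.

(** The index k need not be the first with a nonzero coefficient: u is factored out as long as b_0 =
    0. Once b_0 is nonzero, f cannot vanish where |u| < |b_0| / M. *)
Lemma pser_isolated_zero (b : nat -> C) (r : R) (f : C -> C) (k : nat) :
  0 < r -> pser b r f -> b k <> RtoC 0 ->
  exists s, 0 < s /\ forall u, 0 < Cmod u < s -> f u <> RtoC 0.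
Proof.
revert b f; induction k as [|k IH]; intros b f Hr Hf Hk;
  destruct (Ceq_dec (b O) (RtoC 0)) as [E|Hb]; try easy.
2:{ destruct (pser_divX b r f Hf E) as [g [Hg Eg]].
    destruct (IH _ g Hr Hg Hk) as [s [Hs H]].
    exists (Rmin s r); split; [now apply Rmin_glb_lt|]; intros u Hu.
    pose proof (Rmin_l s r); pose proof (Rmin_r s r).
    rewrite Eg by lra; apply Cmult_neq_0.
    - apply Cmod_gt_0; lra.
    - apply H; lra. }
all: destruct (pser_lipschitz b r f Hr Hf) as [s [M [Hs [HM H]]]].
all: assert (Hb0 : 0 < Cmod (b O)) by now apply Cmod_gt_0.
all: exists (Rmin s (Cmod (b O) / M)); split;
  [apply Rmin_glb_lt; [lra|now apply Rdiv_lt_0_compat]|].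
all: intros u Hu E; pose proof (Rmin_l s (Cmod (b O) / M)); pose proof (Rmin_r s (Cmod (b O) / M)).
all: specialize (H u ltac:(lra)); rewrite E in H.
all: replace (RtoC 0 - b O)%C with (- b O)%C in H by ring; rewrite Cmod_opp in H.
all: assert (Hlt : M * Cmod u < M * (Cmod (b O) / M)) by (apply Rmult_lt_compat_l; lra).
all: replace (M * (Cmod (b O) / M)) with (Cmod (b O)) in Hlt by (field; lra); lra.
Qed.

Lemma pser_zero (b : nat -> C) (r : R) (f : C -> C) (u : C) :
  pser b r f -> (forall k, b k = RtoC 0) -> Cmod u < r -> f u = RtoC 0.
Proof.
intros Hf Hb Hu.
apply (filterlim_locally_unique (K := C_AbsRing) (V := C_NormedModule) (F := eventually) _ _ _ (Hf _ Hu)).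
apply (filterlim_ext (fun _ => RtoC 0)); [|apply filterlim_const].
intros n; induction n as [|n IH].
- rewrite sum_O, Hb; unfold scal; simpl; unfold mult, one; simpl; ring.
- rewrite sum_Sn, <- IH, Hb; unfold plus, scal; simpl; unfold mult; simpl; ring.
Qed.

(** * The identity theorem on connected open sets *)

Definition locally_zero (G : C -> C) (y : C) : Prop :=
  exists s, 0 < s /\ forall u, Cmod (u - y)%C < s -> G u = RtoC 0.

Definition zero_isolated (G : C -> C) (y : C) : Prop :=
  exists s, 0 < s /\ forall u, 0 < Cmod (u - y)%C < s -> G u <> RtoC 0.

Lemma analytic_zero_dichotomy (G : C -> C) (y : C) :
  analytic_at G y -> locally_zero G y \/ zero_isolated G y.
Proof.
intros [b [r [Hr H]]].
assert (Hf : pser b r (fun v => G (y + v)%C)).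
{ intros v Hv; generalize (H (y + v)%C); replace (y + v - y)%C with v by ring; auto. }
assert (Esh : forall u, G u = G (y + (u - y))%C) by (intros u; f_equal; ring).
destruct (classic (exists k, b k <> RtoC 0)) as [[k Hk]|Hn].
- right; destruct (pser_isolated_zero b r _ k Hr Hf Hk) as [s [Hs Hu]].
  exists s; split; [exact Hs|]; intros u Hus; rewrite Esh; now apply Hu.
- left; exists r; split; [exact Hr|]; intros u Hu; rewrite Esh.
  apply (pser_zero b r _ (u - y)%C Hf); [|exact Hu].
  intros k; apply NNPP; intros Hk; apply Hn; now exists k.
Qed.

(** Balls of the uniform structure on C are boxes; side bound s / 2 fits the box into the disc
    because |u - y| is at most the sum of its coordinate distances. *)
Lemma open_of_Cmod (U : C -> Prop) :
  (forall y, U y -> exists s, 0 < s /\ forall u, Cmod (u - y)%C < s -> U u) -> open U.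
Proof.
intros H y Uy; destruct (H y Uy) as [s [Hs Hu]].
exists (mkposreal (s / 2) ltac:(lra)); intros u [B1 B2]; apply Hu.
change (Rabs (Re u - Re y) < s / 2) in B1; change (Rabs (Im u - Im y) < s / 2) in B2.
apply Rle_lt_trans with (Cmod (RtoC (Re u - Re y)) + Cmod (Ci * RtoC (Im u - Im y))%C).
- replace (u - y)%C with (RtoC (Re u - Re y) + Ci * RtoC (Im u - Im y))%C.
  + apply Cmod_triangle.
  + apply injective_projections; simpl; unfold Re, Im; ring.
- rewrite Cmod_mult, !Cmod_R.
  replace (Cmod Ci) with 1 by (unfold Cmod; simpl; rewrite Rmult_0_l, Rplus_0_l, !Rmult_1_r; symmetry; apply sqrt_1).
  lra.
Qed.

Lemma locally_zero_open (G : C -> C) : open (locally_zero G).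
Proof.
apply open_of_Cmod; intros y [s [Hs H]]; exists (s / 2); split; [lra|].
intros u Hu; exists (s / 2); split; [lra|]; intros v Hv; apply H.
replace (v - y)%C with ((v - u) + (u - y))%C by ring.
apply Rle_lt_trans with (1 := Cmod_triangle _ _); lra.
Qed.

(** G may vanish at y itself, so around a point u other than y the radius is also kept below |u -
    y|. *)
Lemma zero_isolated_open (G : C -> C) : open (zero_isolated G).
Proof.
apply open_of_Cmod; intros y [s [Hs H]]; exists s; split; [lra|].
intros u Hu; destruct (Req_dec (Cmod (u - y)%C) 0) as [E|Hne].
- apply Cmod_eq_0 in E; replace u with y; [now exists s|].
  replace u with ((u - y) + y)%C by ring; rewrite E; ring.
- pose proof (Cmod_ge_0 (u - y)%C).
  exists (Rmin (Cmod (u - y)%C) (s - Cmod (u - y)%C)); split; [apply Rmin_glb_lt; lra|].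
  intros v Hv; pose proof (Rmin_l (Cmod (u - y)%C) (s - Cmod (u - y)%C)).
  pose proof (Rmin_r (Cmod (u - y)%C) (s - Cmod (u - y)%C)).
  apply H; split.
  + assert (Ht : Cmod (u - y)%C <= Cmod (v - y)%C + Cmod (v - u)%C).
    { replace (u - y)%C with ((v - y) + - (v - u))%C by ring.
      rewrite <- (Cmod_opp (v - u)%C); apply Cmod_triangle. }
    lra.
  + replace (v - y)%C with ((v - u) + (u - y))%C by ring.
    apply Rle_lt_trans with (1 := Cmod_triangle _ _); lra.
Qed.

Lemma exists_Cmod (y : C) (s : R) : 0 < s -> exists u, 0 < Cmod (u - y)%C < s.
Proof.
intros Hs; exists (y + RtoC (s / 2))%C.
replace (y + RtoC (s / 2) - y)%C with (RtoC (s / 2)) by ring.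
rewrite Cmod_R, Rabs_pos_eq; lra.
Qed.

(** Local vanishing and isolation of zeros are open conditions that cover D and exclude each other.
    The first holds at 1, where zeros accumulate along the half-line, so connectedness rules out the
    second at z. *)
Lemma identity_theorem (G : C -> C) (D : C -> Prop) (z : C) :
  connectedC D -> (forall y, D y -> analytic_at G y) ->
  (forall x : R, 0 < x -> D (RtoC x) /\ G (RtoC x) = RtoC 0) ->
  D z -> G z = RtoC 0.
Proof.
intros Hc Ha Hx Dz.
assert (Hz : locally_zero G z).
{ destruct (analytic_zero_dichotomy G z (Ha z Dz)) as [H|H]; [exact H|exfalso].
  destruct (Hc _ _ (locally_zero_open G) (zero_isolated_open G)) as [y [_ [[s [Hs Hy]] [s' [Hs' Hy']]]]].
  - intros y Dy; now apply analytic_zero_dichotomy, Ha.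
  - exists (RtoC 1); destruct (Hx 1 ltac:(lra)) as [D1 _]; split; [exact D1|].
    destruct (analytic_zero_dichotomy G _ (Ha _ D1)) as [H1|[s [Hs H1]]]; [exact H1|exfalso].
    apply (H1 (RtoC (1 + s / 2))).
    + rewrite <- RtoC_minus, Cmod_R, Rabs_pos_eq; lra.
    + apply Hx; lra.
  - now exists z.
  - destruct (exists_Cmod y (Rmin s s')) as [u Hu]; [now apply Rmin_glb_lt|].
    pose proof (Rmin_l s s'); pose proof (Rmin_r s s').
    apply (Hy' u); [lra|]; apply Hy; lra. }
destruct Hz as [s [Hs H]]; apply H.
replace (z - z)%C with (RtoC 0) by ring; rewrite Cmod_0; exact Hs.
Qed.

(** The factor u is recentred as (u - y) + y, so that the expansion at y only needs a shift and a
    multiple of the coefficients. *)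
Lemma analytic_at_mulX_affine (F : C -> C) (y c : C) :
  analytic_at F y -> analytic_at (fun u => (u * F u - u + c)%C) y.
Proof.
intros [a [r [Hr H]]].
assert (Hf : pser a r (fun v => F (y + v)%C)).
{ intros v Hv; generalize (H (y + v)%C); replace (y + v - y)%C with v by ring; auto. }
assert (Hg := pser_plus _ _ _ _ _ (pser_plus _ _ _ _ _ (pser_mulX _ _ _ Hf) (pser_scal _ _ _ y Hf))
  (pser_plus _ _ _ _ _ (pser_mulX _ _ _ (pser_const (-1) r)) (pser_const (c - y)%C r))).
eexists; exists r; split; [exact Hr|]; intros u Hu.
replace (u * F u - u + c)%C with
  ((u - y) * F (y + (u - y)) + y * F (y + (u - y)) + ((u - y) * (-1) + (c - y)))%C.
- exact (Hg (u - y)%C Hu).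
- replace (y + (u - y))%C with u by ring; ring.
Qed.

(** On the half-line v_L'(x) = 1 - lam / x. The identity theorem is applied to u F(u) - u + lam,
    where the factor u has cleared the denominator and no power series has to be inverted. *)
Lemma laguerre_value (lam : R) (wL : R -> R) (z dvz : C) :
  (forall x, 0 < x -> wL x = rpow x lam * exp (- x)) ->
  value_at (Derive (v_of wL)) z dvz -> (z * dvz = z - RtoC lam)%C.
Proof.
intros HwL.
assert (Hdv : forall x, 0 < x -> Derive (v_of wL) x = 1 - lam / x).
{ intros x Hx; apply is_derive_unique.
  apply (is_derive_ext_loc (fun y => - (lam * ln y + - y))).
  - generalize (open_gt 0 x Hx); apply filter_imp; intros y Hy.
    unfold v_of; rewrite HwL, rpow_Rpower by exact Hy.
    unfold Rpower; rewrite <- exp_plus, ln_exp; reflexivity.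
  - auto_derive; [lra|field; lra]. }
assert (Hreal : forall x, 0 < x -> (RtoC x * RtoC (Derive (v_of wL) x) - RtoC x + RtoC lam)%C = RtoC 0).
{ intros x Hx; rewrite Hdv by exact Hx.
  rewrite <- RtoC_mult, <- RtoC_minus, <- RtoC_plus; f_equal; field; lra. }
assert (Hend : (z * dvz - z + RtoC lam)%C = RtoC 0 -> (z * dvz = z - RtoC lam)%C).
{ intros E; replace (z * dvz)%C with ((z * dvz - z + RtoC lam) + (z - RtoC lam))%C by ring.
  rewrite E; ring. }
intros [[x [Hx [-> ->]]]|[_ [D [F [[_ [Dc [Da DF]]] [Dz ->]]]]]]; apply Hend; [now apply Hreal|].
apply (identity_theorem (fun u => (u * F u - u + RtoC lam)%C) D z Dc); [| |exact Dz].
- intros y Dy; now apply analytic_at_mulX_affine, Da.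
- intros x Hx; destruct (DF x Hx) as [Dx ->]; split; [exact Dx|now apply Hreal].
Qed.

(** * The ladder relations *)

Theorem theorem3p5 :
  forall (lam : R) (w0 : R -> R) (t gamma A B : R)
    (P : nat -> nat -> R) (h : nat -> R) (z dvz : C),
  let wL := w_lag lam w0 in
  let dv := Derive (v_of wL) in
  let w := w_sing wL t gamma A B in
  let A_ := A_fun gamma t dv w P h z dvz in
  let B_ := B_fun gamma t dv w P h z dvz in
  let convA := A_converges t dv w P z dvz in
  let convB := B_converges t dv w P z dvz in
  -1 < lam ->
  laguerre_type lam w0 ->
  0 <= t ->
  0 < gamma ->
  weight_admissible w ->
  monic_orthogonal w P h ->
  z <> RtoC 0 ->
  value_at dv z dvz ->
  (forall n : nat,
     (convA n -> convB n ->
      is_derive (K := C_AbsRing) (V := C_NormedModule) (pC P n) z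
        (- B_ n * pC P n z
         + RtoC (beta h n) * A_ n * prev (RtoC 0) (fun k => pC P k z) n)%C) /\
     (convB n -> prev True convA n ->
      is_derive (K := C_AbsRing) (V := C_NormedModule)
        (fun y => prev (RtoC 0) (fun k => pC P k y) n) z
        ((B_ n + dvz) * prev (RtoC 0) (fun k => pC P k z) n
         - prev (RtoC 0) A_ n * pC P n z)%C)) /\
  ((forall x : R, 0 < x -> wL x = rpow x lam * exp (- x)) ->
   (forall n : nat, convA n ->
      A_ n =
      ((1 - RtoC (R_aux gamma t w P h n)) / z
       + RtoC gamma / RtoC (h n)
         * impintC (cauchy_integrand t w P z n n))%C) /\
   (forall n : nat, (1 <= n)%nat -> convB n ->
      B_ n =
      (- (RtoC (r_aux gamma t w P h n) + RtoC (INR n)) / z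
       + RtoC gamma / RtoC (h (n - 1)%nat)
         * impintC (cauchy_integrand t w P z n (n - 1)))%C)).

Proof.
intros lam w0 t gamma A B P h z dvz wL dv w A_ B_ convA convB
  lam_gt HL t_ge0 gamma_gt0 Hw HP z0 Hv.
assert (Hh : forall n, RtoC (h n) <> RtoC 0).
{ intros n H; apply RtoC_inj in H; revert H.
  exact (norm_nonzero lam w0 t gamma A B P h HL t_ge0 Hw HP n). }
split.
(* For n = 0 both relations read 0 = 0: P_0 is constant, and the conventions set [B_ 0], [beta h 0],
   P_(-1) and A_(-1) to 0. *)
- intros [|m]; split.
  + intros _ _.
    replace (- B_ 0%nat * pC P 0 z
      + RtoC (beta h 0) * A_ 0%nat * prev (RtoC 0) (fun k => pC P k z) 0)%C with (RtoC 0)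
      by (unfold B_; simpl; ring).
    destruct (pC_cpoly w P h HP 0) as [dP HdP].
    replace (RtoC 0) with (dP z) by apply (HdP z).
    exact (cpoly_is_derive 0 _ z _ _ HdP).
  + intros _ _.
    replace ((B_ 0%nat + dvz) * prev (RtoC 0) (fun k => pC P k z) 0
      - prev (RtoC 0) A_ 0 * pC P 0 z)%C with (RtoC 0) by (simpl; ring).
    exact (is_derive_const (K := C_AbsRing) (V := C_NormedModule) (RtoC 0) z).
  + intros [HQ1 [Hp1 Hc1]] [HQ2 [Hp2 Hc2]].
    destruct (pC_cpoly w P h HP (S m)) as [dP HdP].
    destruct (kernel_exists w P h HP m z) as [K [dK HK]].
    pose proof (ladder_identity lam w0 t gamma A B P h lam_gt HL t_ge0 gamma_gt0
      m (S m) z dvz _ _ _ _ _ _ _ K dK dP HK HdP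
      (euler_moment_S w P h HP m z (z * dvz)%C K dK dP HK HdP)
      (impintC_correct _ HQ2) (impintC_correct _ HQ1)
      (impintR_correct _ Hp2) (impintR_correct _ Hp1)
      (impintC_correct _ Hc2) (impintC_correct _ Hc1)) as E.
    match goal with |- is_derive _ _ ?v => replace v with (dP z) end;
      [exact (cpoly_is_derive _ _ z _ _ HdP)|].
    assert (Hm := Hh m); assert (Hn := Hh (S m)).
    (* P_n'(z) is written as the left side of [E] over h_m z, which is 0, plus a remainder; the
       remainder is the claimed right side. *)
    match type of E with (?hm * _ + ?X - ?Y)%C = _ =>
      transitivity ((hm * (z * dP z - RtoC (INR (S m)) * pC P (S m) z) + X - Y) / (hm * z)
        + (RtoC (INR (S m)) * pC P (S m) z - (X - Y) / hm) / z)%C;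
        [field; now split|rewrite E]
    end.
    unfold A_, B_, A_fun, B_fun, beta, prev.
    rewrite RtoC_div by (intros H; apply Hm; now rewrite H).
    field; now repeat split.
  + intros [HQ1 [Hp1 Hc1]] [HQ2 [Hp2 Hc2]].
    destruct (pC_cpoly w P h HP m) as [dP HdP].
    destruct (kernel_exists w P h HP m z) as [K [dK HK]].
    (* With p = P_m the mixed integrals come with indices (m, m + 1), whereas B_n is defined with (m
       + 1, m); the integrands are symmetric. *)
    assert (HQ : has_impintC (quot_integrand dv w P z dvz m (S m))
       (impintC (quot_integrand dv w P z dvz (S m) m))).
    { generalize (impintC_correct _ HQ1); apply (has_impintC_ext nil); intros x _ _.
      unfold quot_integrand; now rewrite (Rmult_comm (pR P (S m) x)). }
    assert (Hp : has_impint (pole_integrand t w P m (S m)) 0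
       (impintR (pole_integrand t w P (S m) m))).
    { generalize (impintR_correct _ Hp1); apply (has_impint_ext nil); intros x _ _.
      unfold pole_integrand; now rewrite (Rmult_comm (pR P (S m) x)). }
    assert (Hc : has_impintC (cauchy_integrand t w P z m (S m))
       (impintC (cauchy_integrand t w P z (S m) m))).
    { generalize (impintC_correct _ Hc1); apply (has_impintC_ext nil); intros x _ _.
      unfold cauchy_integrand; now rewrite (Rmult_comm (pR P (S m) x)). }
    pose proof (ladder_identity lam w0 t gamma A B P h lam_gt HL t_ge0 gamma_gt0
      m m z dvz _ _ _ _ _ _ _ K dK dP HK HdP
      (euler_moment w P h HP m z (z * dvz)%C K dK dP HK HdP)
      (impintC_correct _ HQ2) HQ (impintR_correct _ Hp2) Hp
      (impintC_correct _ Hc2) Hc) as E.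
    simpl prev.
    match goal with |- is_derive _ _ ?v => replace v with (dP z) end;
      [exact (cpoly_is_derive _ _ z _ _ HdP)|].
    assert (Hm := Hh m).
    match type of E with (?hm * ?D + ?X - ?Y)%C = _ =>
      transitivity ((hm * D + X - Y) / (hm * z)
        + (dvz * z * pC P m z - RtoC (INR (S m)) * pC P m z - (X - Y) / hm) / z)%C;
        [field; now split|rewrite E]
    end.
    unfold A_, B_, A_fun, B_fun; field; now split.
- intros HwL; pose proof (laguerre_value lam wL z dvz HwL Hv) as Ez.
  assert (HxdV : forall x, 0 < x -> (RtoC (x * dv x) = RtoC x - RtoC lam)%C).
  { intros x Hx; rewrite RtoC_mult; apply (laguerre_value lam wL (RtoC x) _ HwL).
    left; now exists x. }
  (* With z v_L'(z) = z - lam and x v_L'(x) = x - lam the difference quotient is 1 off x = z, so the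
     integral is an orthogonality relation. *)
  assert (HQ : forall i j, ex_impint (V := C_R_NormedModule) (quot_integrand dv w P z dvz i j) 0 ->
    impintC (quot_integrand dv w P z dvz i j) = if Nat.eq_dec i j then RtoC (h j) else RtoC 0).
  { intros i j Hex; apply (has_impintC_unique _ _ _ (impintC_correct _ Hex)).
    generalize (moment_orthogonal w P h HP i j).
    apply (has_impintC_ext (Re z :: nil)); intros x Hx Hin.
    assert (Hxz : (z - RtoC x)%C <> RtoC 0)
      by (apply C_nonzero_Re; intros ->; apply Hin; now left).
    unfold quot_integrand, pC, pR; rewrite !polyC_RtoC, Ez, HxdV, !RtoC_mult by exact Hx.
    field; exact Hxz. }
  split.
  + intros n [HQn _]; unfold A_, A_fun, R_aux; rewrite (HQ n n HQn).
    destruct (Nat.eq_dec n n) as [_|]; [|lia].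
    assert (Hn := Hh n); rewrite RtoC_mult, RtoC_div by (intros H; apply Hn; now rewrite H).
    field; now split.
  + intros [|m] Hn; [lia|]; intros [HQn _]; unfold B_, B_fun, r_aux.
    replace (S m - 1)%nat with m by lia.
    rewrite (HQ (S m) m HQn); destruct (Nat.eq_dec (S m) m) as [|_]; [lia|].
    assert (Hm := Hh m); rewrite RtoC_mult, RtoC_div by (intros H; apply Hm; now rewrite H).
    field; now split.
Qed.
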